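(* Let $(\Omega,\Sigma,\mu)$ be a complete finite measure space and let $(\mathcal H,L)$ be a measurable bundle of complex Hilbert spaces over $\Omega$. Let $\{a_k\}_{k\ge0}$ be a sequence of complex numbers satisfying the following conditions: (a) for every complex $\lambda$ with $|\lambda|=1$ there exists $c(\lambda)\in\mathbb C$ such that $\frac1n\sum_{k=0}^{n-1}a_k\overline{\lambda}^{\,k}\to c(\lambda)$ as $n\to\infty$; (b) $\displaystyle\sup_{n\ge1}\ \sup_{|\lambda|=1}\Big|\frac1n\sum_{k=0}^{n-1}a_k\lambda^k\Big|<\infty$. Then for any contraction $T$ in $L^0(\Omega,\mathcal H)$, the modulated average $$A_n(a_k,T,\hat u)=\frac1n\sum_{k=0}^{n-1}a_kT^k\hat u$$ converges in norm as $n\to\infty$ for any $\hat u\in L^0(\Omega,\mathcal H)$.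
   Context: $L^0=L^0(\Omega)$ is the algebra of a.e.-equivalence classes of complex measurable functions on $\Omega$; order relations between real elements of $L^0$ are a.e., and $\mathbf 1\in L^0$ is the class of the constant function $1$. Measurable bundle of Hilbert spaces: $\mathcal H$ assigns to each $\omega\in\Omega$ a complex Hilbert space $\mathcal H(\omega)$. A section is a function $u$ defined a.e. on $\Omega$, with domain $\mathrm{dom}(u)$, such that $u(\omega)\in\mathcal H(\omega)$ for $\omega\in\mathrm{dom}(u)$. For a set $L$ of sections, $(\mathcal H,L)$ is a measurable bundle if (1) $\lambda_1c_1+\lambda_2c_2\in L$ for all $\lambda_1,\lambda_2\in\mathbb C$, $c_1,c_2\in L$, where this section is defined pointwise on $\mathrm{dom}(c_1)\cap\mathrm{dom}(c_2)$; (2) $\omega\mapsto\|c(\omega)\|_{\mathcal H(\omega)}$ is measurable for all $c\in L$; (3) for every $\omega\in\Omega$ the set $\{c(\omega):c\in L,\ \omega\in\mathrm{dom}(c)\}$ is dense in $\mathcal H(\omega)$. A step-section is $s(\omega)=\sum_{i=1}^n\chi_{A_i}(\omega)c_i(\omega)$ with $c_i\in L$, $A_i\in\Sigma$. A section $u$ is measurable if there are step-sections $s_n$ with $\|s_n(\omega)-u(\omega)\|_{\mathcal H(\omega)}\to0$ for almost all $\omega$. $M(\Omega,\mathcal H)$ is the set of measurable sections, and $L^0(\Omega,\mathcal H)$ is its quotient by a.e. equality; $\hat u$ is the class of $u$. $L^0(\Omega,\mathcal H)$ is an $L^0$-module under pointwise operations, with $L^0$-valued norm $\|\hat u\|$ =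 the class of $\omega\mapsto\|u(\omega)\|_{\mathcal H(\omega)}$; with the pointwise inner product it is a Hilbert–Kaplansky space over $L^0$ (and every Hilbert–Kaplansky space over $L^0$ is isometrically isomorphic to one of this form). An operator $T:L^0(\Omega,\mathcal H)\to L^0(\Omega,\mathcal H)$ is $L^0$-linear if $T(\alpha x+\beta y)=\alpha T(x)+\beta T(y)$ for all $\alpha,\beta\in L^0$ and all $x,y$; an $L^0$-linear $T$ is $L^0$-bounded if it maps bounded sets (sets $B$ with $\{\|x\|:x\in B\}$ order bounded in $L^0$) to bounded sets. Its norm is $\|T\|=\sup\{\|Tx\|:\|x\|\le\mathbf 1\}\in L^0$. A contraction in $L^0(\Omega,\mathcal H)$ is an $L^0$-linear, $L^0$-bounded operator with $\|T\|\le\mathbf 1$. A sequence $x_n$ in $L^0(\Omega,\mathcal H)$ converges in norm if there is $x\in L^0(\Omega,\mathcal H)$ such that $\|x_n-x\|$ order converges to $0$ in $L^0$, equivalently $\|x_n(\omega)-x(\omega)\|_{\mathcal H(\omega)}\to0$ for almost all $\omega$. *)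

(* Defs.v *)
From HB Require Import structures.
From mathcomp Require Import all_boot all_order all_algebra.
From mathcomp Require Import finmap complex.
From mathcomp Require Import all_classical all_reals all_analysis.
From mathcomp Require Import measurable_realfun measurable_fun_approximation.
Set Implicit Arguments.
Unset Strict Implicit.
Unset Printing Implicit Defensive.
Import Order.TTheory GRing.Theory Num.Theory.
Import numFieldNormedType.Exports.
Local Open Scope classical_set_scope.
Local Open Scope ring_scope.
Local Open Scope complex_scope.

(* R[i] carries the sigma-algebra generated by Re and Im, which is its Borel
   sigma-algebra; a complex function is measurable iff Re f and Im f are. *)
Section complex_measurable.
Context (R : realType).
Let re : R[i] -> measurableTypeR R := @complex.Re R.
Let im : R[i] -> measurableTypeR R := @complex.Im R.

Fact cmeasurable0 : g_sigma_preimageU re im set0.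
Proof. exact: (@sigma_algebra0 _ setT). Qed.

Fact cmeasurableC A :
  g_sigma_preimageU re im A -> g_sigma_preimageU re im (~` A).
Proof. by move=> ?; rewrite -setTD; exact: sigma_algebraCD. Qed.

Fact cmeasurable_bigcup (F : (set R[i])^nat) :
  (forall i, g_sigma_preimageU re im (F i)) ->
  g_sigma_preimageU re im (\bigcup_i F i).
Proof. by move=> ?; exact: sigma_algebra_bigcup. Qed.

HB.instance Definition _ := isPointed.Build R[i] 0.
HB.instance Definition _ := isMeasurable.Build default_measure_display R[i]
  cmeasurable0 cmeasurableC cmeasurable_bigcup.

End complex_measurable.

Section complex_measurable_fun.
Context d (T : measurableType d) (R : realType).
Implicit Types f g : T -> R[i].

Lemma measurable_fun_complexP f : measurable_fun setT f <->
  measurable_fun setT (fun x => complex.Re (f x)) /\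
  measurable_fun setT (fun x => complex.Im (f x)).
Proof.
split=> [mf|[mre mim]].
  split => _ A mA.
    rewrite (_ : _ @^-1` A = f @^-1` (@complex.Re R @^-1` A)) //.
    apply: mf => //; apply: sub_sigma_algebra; left.
    by exists A => //; rewrite setTI.
  rewrite (_ : _ @^-1` A = f @^-1` (@complex.Im R @^-1` A)) //.
  apply: mf => //; apply: sub_sigma_algebra; right.
  by exists A => //; rewrite setTI.
apply: (measurability (preimage_set_system setT (@complex.Re R)
    (measurable : set (set (measurableTypeR R))) `|`
  preimage_set_system setT (@complex.Im R)
    (measurable : set (set (measurableTypeR R))))) => //.
move=> _ [_ [[A mA <-]|[A mA <-]] <-]; rewrite !setTI.
- by rewrite -[X in measurable X]setTI; exact: mre.
- by rewrite -[X in measurable X]setTI; exact: mim.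
Qed.

Lemma cmeasurableD f g : measurable_fun setT f -> measurable_fun setT g ->
  measurable_fun setT (fun x => f x + g x).
Proof.
move=> /measurable_fun_complexP[fr fi] /measurable_fun_complexP[gr gi].
apply/measurable_fun_complexP; split.
- rewrite (_ : (fun _ => _) = (fun x => complex.Re (f x) + complex.Re (g x))).
    exact: measurable_funD.
  by apply/funext => x; case: (f x) (g x) => [? ?] [].
- rewrite (_ : (fun _ => _) = (fun x => complex.Im (f x) + complex.Im (g x))).
    exact: measurable_funD.
  by apply/funext => x; case: (f x) (g x) => [? ?] [].
Qed.

Lemma cmeasurableM f g : measurable_fun setT f -> measurable_fun setT g ->
  measurable_fun setT (fun x => f x * g x).
Proof.
move=> /measurable_fun_complexP[fr fi] /measurable_fun_complexP[gr gi].
apply/measurable_fun_complexP; split.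
- rewrite (_ : (fun _ => _) = (fun x => complex.Re (f x) * complex.Re (g x) -
      complex.Im (f x) * complex.Im (g x))).
    by apply: measurable_funB; exact: measurable_funM.
  by apply/funext => x; case: (f x) (g x) => [? ?] [].
- rewrite (_ : (fun _ => _) = (fun x => complex.Re (f x) * complex.Im (g x) +
      complex.Im (f x) * complex.Re (g x))).
    by apply: measurable_funD; exact: measurable_funM.
  by apply/funext => x; case: (f x) (g x) => [? ?] [].
Qed.

End complex_measurable_fun.

Section L0.
Context d (T : measurableType d) (R : realType).
Variable mu : {measure set T -> \bar R}.

Definition L0 : Type := {mfun_ mu, T >-> R[i]}.
HB.instance Definition _ := Choice.on L0.

Definition L0_fun (f : L0) : T -> R[i] := repr f.
Coercion L0_fun : L0 >-> Funclass.

Definition L0_mk (f : T -> R[i]) (mf : measurable_fun setT f) : L0 :=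
  \pi_(L0)%qT (mfun_Sub (mem_set mf)).

Implicit Types f g h : L0.

Lemma L0P f g : f = g <-> {ae mu, forall x, f x = g x}.
Proof.
split=> [->|fg]; first exact: aeW.
suff : \pi_(L0)%qT (repr f) = \pi_(L0)%qT (repr g) by rewrite !reprK.
by apply/eqquotP/asboolP; apply: filterS fg => x + _.
Qed.

Lemma L0_mkE (f : T -> R[i]) (mf : measurable_fun setT f) :
  {ae mu, forall x, L0_mk mf x = f x}.
Proof.
have : L0_mk mf = \pi_(L0)%qT (repr (L0_mk mf)) by rewrite reprK.
move=> /eqquotP /asboolP h; have := ae_eq_sym h.
by apply: filterS => x /(_ I); rewrite mfun_valP.
Qed.

Lemma L0_measurable f : measurable_fun setT f.
Proof. exact: measurable_funPT. Qed.

Definition L0_cst (c : R[i]) : L0 := L0_mk (measurable_cst c).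

Definition L0_add f g : L0 :=
  L0_mk (cmeasurableD (@L0_measurable f) (@L0_measurable g)).
Definition L0_mul f g : L0 :=
  L0_mk (cmeasurableM (@L0_measurable f) (@L0_measurable g)).
Definition L0_opp f : L0 := L0_mul (L0_cst (-1)) f.

Lemma L0_cstE c : {ae mu, forall x, L0_cst c x = c}.
Proof. exact: L0_mkE. Qed.
Lemma L0_addE f g : {ae mu, forall x, L0_add f g x = f x + g x}.
Proof. exact: L0_mkE. Qed.
Lemma L0_mulE f g : {ae mu, forall x, L0_mul f g x = f x * g x}.
Proof. exact: L0_mkE. Qed.
Lemma L0_oppE f : {ae mu, forall x, L0_opp f x = - f x}.
Proof.
by apply: filterS2 (L0_mulE (L0_cst (-1)) f) (L0_cstE (-1)) => x -> ->;
  rewrite mulN1r.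
Qed.

Fact L0_addA : associative L0_add.
Proof.
move=> f g h; apply/L0P.
apply: filter_app (L0_addE f (L0_add g h)).
apply: filter_app (L0_addE g h).
apply: filter_app (L0_addE (L0_add f g) h).
apply: filter_app (L0_addE f g).
by apply: aeW => x -> -> -> ->; rewrite addrA.
Qed.

Fact L0_addC : commutative L0_add.
Proof.
move=> f g; apply/L0P; apply: filterS2 (L0_addE f g) (L0_addE g f) => x -> ->.
by rewrite addrC.
Qed.

Fact L0_add0 : left_id (L0_cst 0) L0_add.
Proof.
move=> f; apply/L0P; apply: filterS2 (L0_addE (L0_cst 0) f) (L0_cstE 0).
by move=> x -> ->; rewrite add0r.
Qed.

Fact L0_addN : left_inverse (L0_cst 0) L0_opp L0_add.
Proof.
move=> f; apply/L0P.
apply: filterS3 (L0_addE (L0_opp f) f) (L0_oppE f) (L0_cstE 0).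
by move=> x -> -> ->; rewrite addNr.
Qed.

HB.instance Definition _ := GRing.isZmodule.Build L0 L0_addA L0_addC L0_add0 L0_addN.

Fact L0_mulA : associative L0_mul.
Proof.
move=> f g h; apply/L0P.
apply: filter_app (L0_mulE f (L0_mul g h)).
apply: filter_app (L0_mulE g h).
apply: filter_app (L0_mulE (L0_mul f g) h).
apply: filter_app (L0_mulE f g).
by apply: aeW => x -> -> -> ->; rewrite mulrA.
Qed.

Fact L0_mulC : commutative L0_mul.
Proof.
move=> f g; apply/L0P; apply: filterS2 (L0_mulE f g) (L0_mulE g f) => x -> ->.
by rewrite mulrC.
Qed.

Fact L0_mul1 : left_id (L0_cst 1) L0_mul.
Proof.
move=> f; apply/L0P; apply: filterS2 (L0_mulE (L0_cst 1) f) (L0_cstE 1).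
by move=> x -> ->; rewrite mul1r.
Qed.

Fact L0_mulD : left_distributive L0_mul L0_add.
Proof.
move=> f g h; apply/L0P.
apply: filter_app (L0_mulE (L0_add f g) h).
apply: filter_app (L0_addE f g).
apply: filter_app (L0_addE (L0_mul f h) (L0_mul g h)).
apply: filter_app (L0_mulE f h).
apply: filter_app (L0_mulE g h).
by apply: aeW => x -> -> -> -> ->; rewrite mulrDl.
Qed.

HB.instance Definition _ :=
  GRing.Zmodule_isComPzRing.Build L0
  L0_mulA L0_mulC L0_mul1 L0_mulD.

Definition L0_le f g : bool := `[< {ae mu, forall x, f x <= g x} >].

Fact L0_le_refl : reflexive L0_le.
Proof. by move=> f; apply/asboolP/aeW => x. Qed.

Fact L0_le_anti : antisymmetric L0_le.
Proof.
move=> f g /andP[/asboolP fg /asboolP gf]; apply/L0P.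
by apply: filterS2 fg gf => x fg gf; apply/le_anti; rewrite fg gf.
Qed.

Fact L0_le_trans : transitive L0_le.
Proof.
move=> g f h /asboolP fg /asboolP gh; apply/asboolP.
by apply: filterS2 fg gh => x; exact: le_trans.
Qed.

(* The order of R[i] is z <= w iff Re z <= Re w and Im z = Im w, so on real
   elements this is the a.e. order, and an element comparable with a real one is
   real. *)
HB.instance Definition _ :=
  Order.Le_isPOrder.Build ring_display L0
  L0_le_refl L0_le_anti L0_le_trans.

Lemma L0_leP f g : reflect {ae mu, forall x, f x <= g x} (f <= g).
Proof. exact: asboolP. Qed.

Definition L0_bounded (A : set L0) :=
  exists lo hi : L0, forall f, A f -> lo <= f <= hi.

Definition L0_order_cvg (f : L0^nat) (l : L0) := exists g : L0^nat,
  [/\ nonincreasing_seq g, infimums (range g) 0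
    & forall n, l - g n <= f n <= l + g n].

End L0.

HB.mixin Record isHilbert (R : realType) V & CompleteNormedModule R[i] V := {
  hdot : {dot V for (@Num.conj R[i])} ;
  hdotE : forall x : V, hdot x x = `|x| ^+ 2
}.

#[short(type="hilbertType")]
HB.structure Definition Hilbert (R : realType) :=
  {V of CompleteNormedModule R[i] V & isHilbert R V}.

Section sections.
Context d (T : measurableType d) (R : realType).
Variable mu : {measure set T -> \bar R}.
Variable H : T -> hilbertType R.

(* A section defined almost everywhere; None encodes that it is undefined. *)
Record aesection := AESection {
  sec_fun :> forall x, option (H x);
  sec_ae : {ae mu, forall x, isSome (sec_fun x)}
}.

Definition sec_dom (u : aesection) : set T := [set x | isSome (u x)].

Definition sec_val (u : aesection) x : H x := odflt 0 (u x).

Definition sec_on_fun (D : set T) (f : forall x, H x) x : option (H x) :=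
  if x \in D then Some (f x) else None.

Lemma sec_on_ae (D : set T) (f : forall x, H x) : {ae mu, forall x, D x} ->
  {ae mu, forall x, isSome (sec_on_fun D f x)}.
Proof. by apply: filterS => x Dx; rewrite /sec_on_fun mem_set. Qed.

Definition sec_on (D : set T) (aeD : {ae mu, forall x, D x})
  (f : forall x, H x) : aesection := AESection (sec_on_ae f aeD).

Lemma sec_onE (D : set T) (aeD : {ae mu, forall x, D x})
    (f : forall x, H x) :
  {ae mu, forall x, sec_val (sec_on aeD f) x = f x}.
Proof.
by have := aeD; apply: filterS => x Dx; rewrite /sec_val /= /sec_on_fun mem_set.
Qed.

Lemma sec_domI_ae (c1 c2 : aesection) :
  {ae mu, forall x, (sec_dom c1 `&` sec_dom c2) x}.
Proof. by apply: filterS2 (sec_ae c1) (sec_ae c2) => x. Qed.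

Definition sec_lin (l1 l2 : R[i]) (c1 c2 : aesection) : aesection :=
  sec_on (sec_domI_ae c1 c2) (fun x => l1 *: sec_val c1 x + l2 *: sec_val c2 x).

Lemma sec_dom_bigcap_ae n (c : 'I_n -> aesection) :
  {ae mu, forall x, (\bigcap_(i in [set: 'I_n]) sec_dom (c i)) x}.
Proof.
have h (k : nat) : {ae mu, forall x, forall i : 'I_n, val i = k -> c i x}.
  have [kn|kn] := ltnP k n; last first.
    by apply: aeW => x i ik; have := ltn_ord i; rewrite [nat_of_ord i]ik ltnNge kn.
  apply: filterS (sec_ae (c (Ordinal kn))) => x cx i ik.
  by rewrite (_ : i = Ordinal kn)//; exact: val_inj.
by move/ae_foralln: h; apply: filterS => x h i _; exact: (h (val i)).
Qed.

Definition sec_step n (A : 'I_n -> set T) (c : 'I_n -> aesection) : aesection :=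
  sec_on (sec_dom_bigcap_ae c)
    (fun x => \sum_(i < n) \1_(A i) x *: sec_val (c i) x).

End sections.

(* When mu is complete, sec_dom c is measurable, so that bsec_norm is the
   measurability of the norm of c on its domain. *)
Record hilbert_bundle d (T : measurableType d) (R : realType)
    (mu : {measure set T -> \bar R}) := HilbertBundle {
  fiber :> T -> hilbertType R;
  bsec : set (aesection mu fiber);
  bsec_lin : forall (l1 l2 : R[i]) (c1 c2 : aesection mu fiber),
    bsec c1 -> bsec c2 -> bsec (sec_lin l1 l2 c1 c2);
  bsec_norm : forall c, bsec c ->
    measurable_fun (sec_dom c) (fun x => `|sec_val c x|);
  bsec_dense : forall x : T, dense [set v | exists2 c, bsec c & c x = Some v]
}.

Section measurable_sections.
Import HBSimple.
Context d (T : measurableType d) (R : realType).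
Variable mu : {measure set T -> \bar R}.
Variable E : hilbert_bundle mu.

Definition step_section (s : aesection mu E) := exists n (A : 'I_n -> set T)
  (c : 'I_n -> aesection mu E), [/\ forall i, measurable (A i),
    forall i, bsec (c i) & s = sec_step A c].

(* For almost every x all the s n and u are defined at x, so the value of
   sec_val outside of the domains is irrelevant. *)
Definition measurable_section (u : aesection mu E) :=
  exists s : nat -> aesection mu E, (forall n, step_section (s n)) /\
  {ae mu, forall x,
    `|sec_val (s n) x - sec_val u x| @[n --> \oo] --> (0 : R[i]^o)}.

Definition mapprox (f : forall x, E x) := exists g : nat -> forall x, E x,
  (forall n, exists (I : finType) (A : I -> set T) (c : I -> aesection mu E),
    [/\ forall i, measurable (A i), forall i, bsec (c i) &
     {ae mu, forall x, g n x = \sum_i \1_(A i) x *: sec_val (c i) x}]) /\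
  {ae mu, forall x, g ^~ x @ \oo --> f x}.

Lemma measurable_section_sub (u : aesection mu E) :
  measurable_section u -> mapprox (sec_val u).
Proof.
move=> [s [ss su]]; exists (fun n => sec_val (s n)); split.
  move=> n; have [m [A [c [mA cE ->]]]] := ss n.
  by exists 'I_m, A, c; split => //; exact: sec_onE.
apply: filterS su => x /norm_cvg0P h.
by apply/subr_cvg0.
Qed.

Lemma mapprox_section (u : aesection mu E) (f : forall x, E x) :
  mapprox f -> {ae mu, forall x, sec_val u x = f x} -> measurable_section u.
Proof.
move=> [g [gs gf]] uf.
have /choice[s hs] : forall n, exists s, step_section s /\
    {ae mu, forall x, sec_val s x = g n x}.
  move=> n; have [I [A [c [mA cE gE]]]] := gs n.
  pose A' := A \o @enum_val I predT; pose c' := c \o @enum_val I predT.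
  exists (sec_step A' c'); split.
    by exists #|I|, A', c'; split => // i; [exact: mA|exact: cE].
  apply: filterS2 gE (sec_onE (sec_dom_bigcap_ae c')
    (fun x => \sum_(i < #|I|) \1_(A' i) x *: sec_val (c' i) x)) => x -> ->.
  by rewrite [RHS]big_enum_val.
exists s; split; first by move=> n; case: (hs n).
have /ae_foralln sg : forall n, {ae mu, forall x, sec_val (s n) x = g n x}.
  by move=> n; case: (hs n).
apply: filterS3 sg gf uf => x sg gf ->.
apply/norm_cvg0P/subr_cvg0.
by rewrite (_ : (fun n => _) = g ^~ x)//; apply/funext.
Qed.

Let mapproxD f g : mapprox f -> mapprox g -> mapprox (fun x => f x + g x).
Proof.
move=> [f_ [fs ff]] [g_ [gs gg]]; exists (fun n x => f_ n x + g_ n x); split.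
  move=> n; have [I [A [c [mA cE fE]]]] := fs n.
  have [J [B [e [mB eE gE]]]] := gs n.
  exists (I + J)%type, (fun k => match k with inl i => A i | inr j => B j end),
    (fun k => match k with inl i => c i | inr j => e j end).
  split; [by case|by case|].
  by apply: filterS2 fE gE => x -> ->; rewrite big_sumType.
by apply: filterS2 ff gg => x ff gg; exact: cvgD.
Qed.

Definition csimple (f : T -> R[i]) := exists (I : finType) (B : I -> set T)
  (l : I -> R[i]), (forall i, measurable (B i)) /\
  forall x, f x = \sum_i l i * \1_(B i) x.

Let rapprox (k : R[i]) (f : T -> R) : measurable_fun setT f ->
  exists g : nat -> T -> R[i], (forall n, csimple (g n)) /\
   forall x, g ^~ x @ \oo --> (k * (f x)%:C : R[i]^o).
Proof.
move=> /measurable_EFinP mf.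
have [g gf] := approximation_sfun measurableT mf.
exists (fun n x => k * (g n x)%:C); split.
  move=> n; pose s := fset_set (g n @` setT).
  exists 'I_(#|` s|)%fset, (fun i => g n @^-1` [set s`_(val i)]),
    (fun i => k * (s`_(val i))%:C).
  split=> [i|x].
    by rewrite -[X in measurable X]setTI; exact: measurable_funPT.
  rewrite [in LHS](fimfunEord (g n) x) rmorph_sum mulr_sumr.
  apply: eq_bigr => i _; rewrite rmorphM mulrA /=; congr (_ * _).
  by rewrite !indicE rmorph_nat.
move=> x; have /fine_cvgP[_ /= gx] := gf x I.
apply: (@cvgMl_tmp R[i]).
apply/cvgrPdist_lt => e e0.
have e1 : 0 < complex.Re e by case: e e0 => a b /=; rewrite ltcE /= => /andP[].
have /cvgrPdist_lt/(_ _ e1) := gx.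
apply: filterS => n; rewrite -rmorphB /= normc_def /= expr0n /= addr0 sqrtr_sqr.
rewrite -ltcR => /lt_le_trans; apply.
by case: e e0 {e1} => a b; rewrite ltcE lecE /= => /andP[/eqP ->]; rewrite eqxx lexx.
Qed.

Let cmapprox (f : T -> R[i]) : measurable_fun setT f ->
  exists g : nat -> T -> R[i], (forall n, csimple (g n)) /\
   forall x, g ^~ x @ \oo --> (f x : R[i]^o).
Proof.
move=> /measurable_fun_complexP[mre mim].
have [g [gs gf]] := rapprox 1 mre; have [h [hs hf]] := rapprox 'i%C mim.
exists (fun n x => g n x + h n x); split.
  move=> n; have [I [B [l [mB gE]]]] := gs n.
  have [J [B' [l' [mB' hE]]]] := hs n.
  exists (I + J)%type, (fun k => match k with inl i => B i | inr j => B' j end),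
    (fun k => match k with inl i => l i | inr j => l' j end).
  by split=> [[]//|x]; rewrite big_sumType /= gE hE.
move=> x; rewrite (_ : f x = 1 * (complex.Re (f x))%:C +
    'i%C * (complex.Im (f x))%:C).
  exact: (@cvgD _ R[i]^o _ _ _ _ _ _ _ (gf x) (hf x)).
by case: (f x) => a b; apply/eqP;
  rewrite mul1r eq_complex /= !mul0r !mul1r !(add0r, addr0, subr0, mulr0) ?eqxx.
Qed.

Let mapproxZ (a : T -> R[i]) f : measurable_fun setT a -> mapprox f ->
  mapprox (fun x => a x *: f x).
Proof.
move=> /cmapprox[a_ [as_ aa]] [f_ [fs ff]].
exists (fun n x => a_ n x *: f_ n x); split; last first.
  by apply: filterS ff => x ff; apply: cvgZ => //; exact: aa.
move=> n; have [I [A [c [mA cE fE]]]] := fs n.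
have [J [B [l [mB aE]]]] := as_ n.
exists (J * I)%type, (fun k => B k.1 `&` A k.2),
  (fun k => sec_lin (l k.1) 0 (c k.2) (c k.2)); split.
- by move=> k; exact: measurableI.
- by move=> k; exact: bsec_lin.
have h : {ae mu, forall x, forall i : I, c i x}.
  have := sec_dom_bigcap_ae (c \o @enum_val I predT).
  apply: filterS => x h i; have := h (enum_rank i) Logic.I.
  by rewrite /sec_dom /= enum_rankK.
apply: filterS2 fE h => x -> h; rewrite aE scaler_suml.
under eq_bigr do rewrite scaler_sumr.
rewrite pair_big /=; apply: eq_bigr => -[j i] _ /=.
rewrite {2}/sec_val /= /sec_on_fun mem_set; last by split; exact: h.
rewrite /= scale0r addr0 !scalerA; congr (_ *: _).
by rewrite !indicE in_setI -mulnb natrM -mulrA mulrC.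
Qed.


Definition sec_add (u v : aesection mu E) : aesection mu E :=
  sec_on (sec_domI_ae u v) (fun x => sec_val u x + sec_val v x).

Definition sec_scale (a : T -> R[i]) (u : aesection mu E) : aesection mu E :=
  sec_on (sec_ae u) (fun x => a x *: sec_val u x).

Definition sec_zero : aesection mu E :=
  sec_on (aeW mu (fun x => Logic.I : [set: T] x)) (fun x => 0).

Lemma sec_addE u v :
  {ae mu, forall x, sec_val (sec_add u v) x = sec_val u x + sec_val v x}.
Proof. exact: sec_onE. Qed.

Lemma sec_scaleE a u :
  {ae mu, forall x, sec_val (sec_scale a u) x = a x *: sec_val u x}.
Proof. exact: sec_onE. Qed.

Lemma sec_zeroE : {ae mu, forall x, sec_val sec_zero x = 0}.
Proof. exact: sec_onE. Qed.

Lemma measurable_sec_add u v : measurable_section u -> measurable_section v ->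
  measurable_section (sec_add u v).
Proof.
move=> /measurable_section_sub mu_ /measurable_section_sub mv.
exact: mapprox_section (mapproxD mu_ mv) (sec_onE _ _).
Qed.

Lemma measurable_sec_scale a u : measurable_fun setT a ->
  measurable_section u -> measurable_section (sec_scale a u).
Proof.
move=> ma /measurable_section_sub mu_.
exact: mapprox_section (mapproxZ ma mu_) (sec_onE _ _).
Qed.

Lemma measurable_sec_zero : measurable_section sec_zero.
Proof.
apply: mapprox_section (sec_onE _ _).
exists (fun _ _ => 0); split; last by apply: aeW => x; exact: cvg_cst.
move=> n; exists 'I_0, (fun=> set0), (fun=> sec_zero).
by split; [case|case|apply: aeW => x; rewrite big_ord0].
Qed.

Section norm.
Hypothesis cmu : measure_is_complete mu.

Let ae_meas d' (X : measurableType d') (f g : T -> X) :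
  {ae mu, forall x, f x = g x} -> measurable_fun setT f ->
  measurable_fun setT g.
Proof.
move=> [N [mN N0 subN]] mf _ B mB; rewrite setTI.
rewrite [X in measurable X](_ : _ = (f @^-1` B `&` ~` N) `|` (g @^-1` B `&` N)).
  apply: measurableU.
    by apply: measurableI; [rewrite -[X in measurable X]setTI; exact: mf|
      exact: measurableC].
  by apply: cmu; exists N; split => // x [].
apply/seteqP; split=> x /=.
  move=> Bgx; have [xN|xN] := pselect (N x); first by right.
  by left; split => //; have /contrapT -> := contra_not (@subN x) xN.
move=> [[Bfx xN]|[]//].
by have /contrapT <- := contra_not (@subN x) xN.
Qed.

Let bsec_measurable c : bsec (h := E) c ->
  measurable_fun setT (fun x => `|sec_val c x|).
Proof.
move=> cE.
have [N [mN N0 subN]] := sec_ae c.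
have mD : measurable (sec_dom c).
  rewrite -[X in measurable X]setCK; apply: measurableC; apply: cmu.
  by exists N; split.
move=> _ B mB; rewrite setTI.
rewrite [X in measurable X](_ : _ =
   (sec_dom c `&` (fun x => `|sec_val c x|) @^-1` B) `|`
   (~` sec_dom c `&` (fun x => `|sec_val c x|) @^-1` B)).
  apply: measurableU; first exact: bsec_norm.
  by apply: cmu; exists N; split => // x [+ _]; exact: subN.
by rewrite -setIUl setUv setTI.
Qed.

Let step_measurable (I : Type) (r : seq I) (A : I -> set T)
    (c : I -> aesection mu E) : (forall i, measurable (A i)) ->
  (forall i, bsec (c i)) -> forall c0, bsec c0 -> measurable_fun setT
  (fun x => `|sec_val c0 x + \sum_(i <- r) \1_(A i) x *: sec_val (c i) x|).
Proof.
move=> mA cE; elim: r => [|i r ih] c0 c0E.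
  under eq_fun do rewrite big_nil addr0.
  exact: bsec_measurable.
have h1 := ih _ (bsec_lin 1 1 c0E (cE i)); have h0 := ih _ c0E.
have mi : measurable_fun setT (fun x => x \in A i).
  by apply: (measurable_fun_bool true); rewrite setTI preimage_mem_true.
apply: ae_meas (measurable_fun_ifT mi h1 h0).
apply: filterS2 (sec_onE (sec_domI_ae c0 (c i))
  (fun x => 1 *: sec_val c0 x + 1 *: sec_val (c i) x)) (sec_ae c0) => x + _.
rewrite /sec_lin => ->; rewrite big_cons indicE.
by case: (x \in A i); rewrite ?scale0r ?add0r// !scale1r addrA.
Qed.

Let normr_complex (V : normedModType R[i]) (v : V) :
  `|v| = (complex.Re `|v|)%:C.
Proof.
have : 0 <= `|v| by exact: normr_ge0.
by case: `|v| => a b; rewrite lecE /= => /andP[/eqP -> _].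
Qed.

Lemma measurable_sec_norm u : measurable_section u ->
  measurable_fun setT (fun x => `|sec_val u x|).
Proof.
move=> /measurable_section_sub[g [gs gu]].
suff : measurable_fun setT (fun x => complex.Re `|sec_val u x|).
  move=> h; apply/measurable_fun_complexP; split => //.
  rewrite (_ : (fun x => _) = cst 0)//; apply/funext => x.
  by rewrite normr_complex.
have mg n : measurable_fun setT (fun x => complex.Re `|g n x|).
  have [I [A [c [mA cE gE]]]] := gs n.
  have [c0 c0E] : exists c : aesection mu E, bsec c.
    have [|v [_ [c' c'E _]]] := @bsec_dense _ _ _ _ E point setT _ openT.
      by exists 0.
    by exists c'.
  have h := step_measurable (index_enum I) mA cE (bsec_lin 0 0 c0E c0E).
  have : measurable_fun setT (fun x => `|g n x|).
    apply: ae_meas h; apply: filterS2 gE (sec_onE (sec_domI_ae c0 c0)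
      (fun x => 0 *: sec_val c0 x + 0 *: sec_val c0 x)) => x ->.
    by rewrite /sec_lin => ->; rewrite !scale0r !add0r.
  by move=> /measurable_fun_complexP[].
have [N [mN N0 subN]] := gu.
have ucv x : ~ N x ->
    complex.Re `|g n x| @[n --> \oo] --> complex.Re `|sec_val u x|.
  move=> xN; have /contrapT gx := contra_not (@subN x) xN.
  move: gx => /cvg_norm gx.
  apply/cvgrPdist_lt => e e0.
  have e1 : 0 < e%:C :> R[i] by rewrite ltcR.
  have : \forall n \near \oo, `| (`|sec_val u x| - `|g n x| : R[i]) | < e%:C.
    exact: (@cvgrPdist_lt _ R[i]^o _ _ _ _ _).1 gx _ e1.
  apply: filterS => n; rewrite normr_complex [in X in _ - X]normr_complex.
  by rewrite -rmorphB /= normc_def /= expr0n addr0 sqrtr_sqr ltcR.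
pose v x := complex.Re `|sec_val u x| * \1_(~` N) x.
apply: (@ae_meas _ _ v).
  exists N; split => // x; apply: contra_notP => xN.
  by rewrite /= /v indicE mem_set// mulr1.
apply: (@measurable_fun_cvg _ _ _ _
  (fun n x => complex.Re `|g n x| * \1_(~` N) x)).
  by move=> n; apply: measurable_funM => //; apply: measurable_indic; exact: measurableC.
move=> x _; rewrite /v indicE; have [xN|xN] := boolP (x \in ~` N).
  by apply: cvgMr_tmp; apply: ucv; move: xN; rewrite inE.
by rewrite !mulr0; under eq_fun do rewrite mulr0; exact: cvg_cst.
Qed.

End norm.
End measurable_sections.

Section L0H.
Context d (T : measurableType d) (R : realType).
Variable mu : {measure set T -> \bar R}.
Variable E : hilbert_bundle mu.

Record msection := MSection {
  msec :> aesection mu E;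
  msec_measurable : measurable_section msec
}.

HB.instance Definition _ := gen_eqMixin msection.
HB.instance Definition _ := gen_choiceMixin msection.

Definition msec_eq (u v : msection) : bool :=
  `[< {ae mu, forall x, msec u x = msec v x} >].

Fact msec_eq_refl : reflexive msec_eq.
Proof. by move=> u; apply/asboolP/aeW. Qed.

Fact msec_eq_sym : symmetric msec_eq.
Proof.
by move=> u v; apply/idP/idP => /asboolP h; apply/asboolP; apply: filterS h.
Qed.

Fact msec_eq_trans : transitive msec_eq.
Proof.
move=> v u w /asboolP uv /asboolP vw; apply/asboolP.
by apply: filterS2 uv vw => x -> ->.
Qed.

Canonical msec_eq_canonical :=
  EquivRel msec_eq msec_eq_refl msec_eq_sym msec_eq_trans.

Definition L0H : Type := {eq_quot msec_eq}%qT.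
HB.instance Definition _ := Choice.on L0H.
HB.instance Definition _ := EqQuotient.on L0H.

Definition L0H_mk (u : msection) : L0H := \pi_(L0H)%qT u.

Definition L0H_val (u : L0H) x : E x := sec_val (repr u) x.

Implicit Types u v w : L0H.

Lemma L0H_mkE (u : msection) :
  {ae mu, forall x, L0H_val (L0H_mk u) x = sec_val u x}.
Proof.
have : \pi_(L0H)%qT (repr (L0H_mk u)) = \pi_(L0H)%qT u by rewrite reprK.
move=> /eqquotP /asboolP; apply: filterS => x.
by rewrite /L0H_val /sec_val => ->.
Qed.

Lemma L0HP u v : u = v <-> {ae mu, forall x, L0H_val u x = L0H_val v x}.
Proof.
split=> [->|uv]; first exact: aeW.
suff : \pi_(L0H)%qT (repr u) = \pi_(L0H)%qT (repr v) by rewrite !reprK.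
apply/eqquotP/asboolP.
apply: filterS3 uv (sec_ae (repr u)) (sec_ae (repr v)) => x.
by rewrite /L0H_val /sec_val; case: (msec _ x) => // a;
  case: (msec _ x) => //= b ->.
Qed.

Definition L0H_zero : L0H := L0H_mk (MSection (measurable_sec_zero E)).

Definition L0H_add u v : L0H := L0H_mk (MSection
  (measurable_sec_add (msec_measurable (repr u)) (msec_measurable (repr v)))).

Definition L0H_scale (a : L0 mu) u : L0H := L0H_mk (MSection
  (measurable_sec_scale (@L0_measurable _ _ _ _ a) (msec_measurable (repr u)))).

Definition L0H_opp u : L0H := L0H_scale (L0_cst mu (-1)) u.

Lemma L0H_zeroE : {ae mu, forall x, L0H_val L0H_zero x = 0}.
Proof.
by apply: filterS2 (L0H_mkE (MSection (measurable_sec_zero E)))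
  (sec_zeroE E) => x -> ->.
Qed.

Lemma L0H_addE u v :
  {ae mu, forall x, L0H_val (L0H_add u v) x = L0H_val u x + L0H_val v x}.
Proof.
apply: filterS2 (L0H_mkE (MSection (measurable_sec_add
  (msec_measurable (repr u)) (msec_measurable (repr v)))))
  (sec_addE (repr u) (repr v)) => x -> ->.
by [].
Qed.

Lemma L0H_scaleE (a : L0 mu) u :
  {ae mu, forall x, L0H_val (L0H_scale a u) x = a x *: L0H_val u x}.
Proof.
by apply: filterS2 (L0H_mkE (MSection (measurable_sec_scale
  (@L0_measurable _ _ _ _ a) (msec_measurable (repr u)))))
  (sec_scaleE a (repr u)) => x -> ->.
Qed.

Lemma L0H_oppE u : {ae mu, forall x, L0H_val (L0H_opp u) x = - L0H_val u x}.
Proof.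
apply: filterS2 (L0H_scaleE (L0_cst mu (-1)) u) (L0_cstE mu (-1)) => x -> ->.
by rewrite scaleN1r.
Qed.

Fact L0H_addA : associative L0H_add.
Proof.
move=> u v w; apply/L0HP.
apply: filter_app (L0H_addE u (L0H_add v w)).
apply: filter_app (L0H_addE v w).
apply: filter_app (L0H_addE (L0H_add u v) w).
apply: filter_app (L0H_addE u v).
by apply: aeW => x -> -> -> ->; rewrite addrA.
Qed.

Fact L0H_addC : commutative L0H_add.
Proof.
move=> u v; apply/L0HP.
by apply: filterS2 (L0H_addE u v) (L0H_addE v u) => x -> ->; rewrite addrC.
Qed.

Fact L0H_add0 : left_id L0H_zero L0H_add.
Proof.
move=> u; apply/L0HP; apply: filterS2 (L0H_addE L0H_zero u) L0H_zeroE.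
by move=> x -> ->; rewrite add0r.
Qed.

Fact L0H_addN : left_inverse L0H_zero L0H_opp L0H_add.
Proof.
move=> u; apply/L0HP.
apply: filterS3 (L0H_addE (L0H_opp u) u) (L0H_oppE u) L0H_zeroE.
by move=> x -> -> ->; rewrite addNr.
Qed.

HB.instance Definition _ := GRing.isZmodule.Build L0H
  L0H_addA L0H_addC L0H_add0 L0H_addN.

Fact L0H_scaleA a b u : L0H_scale a (L0H_scale b u) = L0H_scale (a * b) u.
Proof.
apply/L0HP.
apply: filter_app (L0H_scaleE a (L0H_scale b u)).
apply: filter_app (L0H_scaleE b u).
apply: filter_app (L0H_scaleE (a * b) u).
apply: filter_app (L0_mulE a b).
by apply: aeW => x -> -> -> ->; rewrite scalerA.
Qed.

Fact L0H_scale1 : left_id 1 L0H_scale.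
Proof.
move=> u; apply/L0HP; apply: filterS2 (L0H_scaleE 1 u) (L0_cstE mu 1).
by move=> x -> ->; rewrite scale1r.
Qed.

Fact L0H_scaleDr : right_distributive L0H_scale +%R.
Proof.
move=> a u v; apply/L0HP.
apply: filter_app (L0H_scaleE a (u + v)).
apply: filter_app (L0H_addE u v).
apply: filter_app (L0H_addE (L0H_scale a u) (L0H_scale a v)).
apply: filter_app (L0H_scaleE a u).
apply: filter_app (L0H_scaleE a v).
by apply: aeW => x -> -> -> -> ->; rewrite scalerDr.
Qed.

Fact L0H_scaleDl u : {morph L0H_scale^~ u : a b / a + b}.
Proof.
move=> a b; apply/L0HP.
apply: filter_app (L0H_scaleE (a + b) u).
apply: filter_app (L0_addE a b).
apply: filter_app (L0H_addE (L0H_scale a u) (L0H_scale b u)).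
apply: filter_app (L0H_scaleE a u).
apply: filter_app (L0H_scaleE b u).
by apply: aeW => x -> -> -> -> ->; rewrite scalerDl.
Qed.

HB.instance Definition _ := GRing.Zmodule_isLmodule.Build (L0 mu) L0H
  L0H_scaleA L0H_scale1 L0H_scaleDr L0H_scaleDl.

Section norm.
Hypothesis cmu : measure_is_complete mu.

Definition L0H_norm u : L0 mu :=
  L0_mk mu (measurable_sec_norm cmu (msec_measurable (repr u))).

Lemma L0H_normE u : {ae mu, forall x, L0H_norm u x = `|L0H_val u x|}.
Proof. exact: L0_mkE. Qed.

Definition L0H_bounded (B : set L0H) := L0_bounded (L0H_norm @` B).

Definition L0_bounded_operator (S : L0H -> L0H) :=
  forall B, L0H_bounded B -> L0H_bounded (S @` B).

(* The supremum is given as a relation: N is the norm of S. *)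
Definition operator_norm (S : L0H -> L0H) (N : L0 mu) :=
  supremums [set L0H_norm (S u) | u in [set u | L0H_norm u <= 1]] N.

Definition L0_contraction (S : {linear L0H -> L0H}) :=
  L0_bounded_operator S /\ exists2 N, operator_norm S N & N <= 1.

Definition cvg_in_norm (u : nat -> L0H) := exists v : L0H,
  L0_order_cvg (fun n => L0H_norm (u n - v)) 0.

End norm.

Definition modulated_average (a : nat -> R[i]) (S : L0H -> L0H) (n : nat) u :
  L0H := L0_cst mu n%:R^-1 *: \sum_(k < n) L0_cst mu (a k) *: iter k S u.

End L0H.

(* Main.v *)
Require Import Defs.
From mathcomp Require Import all_boot all_order all_algebra.
From mathcomp Require Import complex.
From mathcomp Require Import all_classical all_reals all_analysis.
From mathcomp Require Import measurable_realfun.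
From mathcomp Require Import ring lra zify.
Set Implicit Arguments.
Unset Strict Implicit.
Unset Printing Implicit Defensive.
Import Order.TTheory GRing.Theory Num.Theory.
Import numFieldNormedType.Exports.
Local Open Scope classical_set_scope.
Local Open Scope ring_scope.

                                                                               
                                                                          
                                                                               
                                                                        
                                                                                
                                                       

                                                                            
                                                                   
                                                             
                                                                            
                                                                              
                                                                           
                                                                               
                                                                            
                                                                               
                                             

                                                                         
                                                                               
                                                                  

                                                     

(** Convergence is proved fibre by fibre. Since [S] is [L0]-linear, multiplying by indicators
    localises the bound on its norm: |(S u)(x)| <= |u(x)| for almost every x. Used for the countably
    many combinations of the orbit with complex rational coefficients and extended by density, this
    shows that for almost every x the vectors w_k = (S^k u)(x) satisfy |sum c_k w_{k+1}| <= |sum c_k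
    w_k| for all complex c ([orbit_pointwise_contraction]).

    For such a sequence in a Hilbert space, the Toeplitz form with entries <w_{j-k}, w_0>
    (conjugated below the diagonal j = k) dominates |sum c_k w_k|^2 ([norm_le_qform]); hence it is
    nonnegative, and by Herglotz it is the integral of |sum c_k z^k|^2 against a positive measure on
    the circle. Here a positive functional stands for that measure: a generalized limit of Riemann
    sums weighted by Fejer means. Dominated convergence for it is [bounded_convergence]. The
    trigonometric polynomial attached to the difference of two averages is bounded on the circle by
    (b) and tends to 0 pointwise by (a), so the averages of w are Cauchy ([average_cauchy]).

    It remains to pass from convergence in almost every fibre to convergence in norm. The pointwise
    limit is a measurable section, by a diagonal choice of step-sections ([mapprox_limit]), and the
    tail suprema of the distances to it witness order convergence ([ae_cvg0_order_cvg]). *)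

(** * Positive functionals on continuous functions and bounded convergence *)

Section generalized_limit.
Context (R : realType).
Implicit Types u v : nat -> R.

Definition bounded_seq u := exists C, forall n, `|u n| <= C.

                                                      
(** The limit along an ultrafilter finer than the filter at infinity: a bounded sequence stays in a
    compact segment, so its image ultrafilter has a cluster point and converges to it. *)
Lemma generalized_limit : exists L : (nat -> R) -> R,
  [/\ forall u v, bounded_seq u -> bounded_seq v ->
        L (fun n => u n + v n) = L u + L v,
      forall u v, bounded_seq u -> bounded_seq v -> (forall n, u n <= v n) ->
        L u <= L v &
      forall u l, u n @[n --> \oo] --> l -> L u = l].
Proof.
have [U [UU oU]] := @ultraFilterLemma nat \oo _.
have UP : ProperFilter U by exact: ultra_proper.
have cvgU u : bounded_seq u -> cvg (u @ U).
  move=> [C uC].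
  have uI : (u @ U) `[- C, C]%classic.
    by apply: (@nearW _ U) => n /=; rewrite in_itv/= -ler_norml.
  have [p [_ pu]] := @segment_compact _ (- C) C (u @ U) _ uI.
  apply: (cvgP p) => B /= pB.
  have [//|uB] := in_ultra_setVsetC (u @^-1` B) UU.
  by have [x [+ Bx]] := pu (~` B) B uB pB.
exists (fun u => lim (u @ U)); split.
- by move=> u v /cvgU cu /cvgU cv; rewrite limD.
- move=> u v /cvgU cu /cvgU cv uv; apply: ler_lim => //.
  exact: nearW.
- move=> u l ul; apply/cvg_lim => //.
  by apply: cvg_trans ul => A /= ?; exact: oU.
Qed.

End generalized_limit.

Section dini.
Context (R : realType) (a b : R).

Lemma dini (h : nat -> R -> R) : (forall n, continuous (h n)) ->
  (forall n x, h n.+1 x <= h n x) ->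
  (forall x, a <= x <= b -> forall e, 0 < e -> exists n, h n x < e) ->
  forall e, 0 < e -> exists n, forall x, a <= x <= b -> h n x < e.
Proof.
move=> hc hd h0 e e0.
have /compact_near_coveringP cpt := @segment_compact _ a b.
have [|n _ hn] := cpt nat \oo (fun n x => h n x < e) _.
  move=> x /=; rewrite in_itv/= => /h0/(_ _ e0)[n hn].
  have dec m y : (n <= m)%N -> h m y <= h n y.
    by move=> /subnK <-; elim: (m - n)%N => // k; exact: le_trans (hd _ _).
  exists ([set y | h n y < e], [set m | (n <= m)%N]) => /=.
    split; last by exists n.
    exact: (cvgr_lt _ (hc n x)).
  by case=> y m /= [hy nm]; exact: le_lt_trans (dec _ _ nm) hy.
by exists n => x xab; apply: (hn n) => //=; rewrite in_itv.
Qed.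
End dini.

Lemma continuous_fun_max (R : realType) (f g : R -> R) :
  continuous f -> continuous g -> continuous (fun x => Num.max (f x) (g x)).
Proof. by move=> cf cg x; exact: (@continuous_max _ _ f g x (cf x) (cg x)). Qed.

Lemma continuous_fun_min (R : realType) (f g : R -> R) :
  continuous f -> continuous g -> continuous (fun x => Num.min (f x) (g x)).
Proof. by move=> cf cg x; exact: (@continuous_min _ _ f g x (cf x) (cg x)). Qed.

Section bounded_convergence.
Context (R : realType) (a b C B : R) (L : (R -> R) -> R).
Hypothesis LD : forall f g : R -> R, continuous f -> continuous g ->
  L (fun x => f x + g x) = L f + L g.
Hypothesis Lle : forall f g : R -> R, continuous f -> continuous g ->
  (forall x, a <= x <= b -> f x <= g x) -> L f <= L g.
Hypothesis Lcst : forall r, 0 <= r -> L (fun=> r) <= C * r.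
Variable f : nat -> R -> R.
Hypothesis fc : forall n, continuous (f n).
Hypothesis fB : forall n x, a <= x <= b -> f n x <= B.
Hypothesis f0 : forall x e, a <= x <= b -> 0 < e -> exists n, forall m,
  (n <= m)%N -> f m x < e.

Let LB (g h : R -> R) : continuous g -> continuous h ->
  L (fun x => g x - h x) = L g - L h.
Proof.
move=> cg ch; apply/eqP; rewrite -subr_eq opprK -LD//; last first.
  by move=> x; apply: continuousB; [exact: cg|exact: ch].
by apply/eqP; congr L; apply/funext => x; rewrite subrK.
Qed.

Fixpoint window_max n k x :=
  if k is k'.+1 then Num.max (window_max n k' x) (f (n + k'.+1) x) else f n x.

Let wmc n k : continuous (window_max n k).
Proof. by elim: k => //= k ih; apply: continuous_fun_max. Qed.

Let wm_le n k x r : (forall m, (n <= m)%N -> (m <= n + k)%N -> f m x <= r) ->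
  window_max n k x <= r.
Proof.
elim: k => [|k ih] h /=; first by apply: h; rewrite ?addn0.
rewrite ge_max h ?leq_addr// andbT; apply: ih => m nm mk.
by apply: h => //; rewrite (leq_trans mk)// leq_add2l.
Qed.

Let wm_ge n k x m : (n <= m)%N -> (m <= n + k)%N -> f m x <= window_max n k x.
Proof.
elim: k => [|k ih] nm mk /=.
  by have /eqP -> : (m == n)%N by rewrite eqn_leq nm andbT -(addn0 n).
rewrite le_max; move: mk; rewrite addnS leq_eqVlt => /predU1P[->|mk].
  by rewrite lexx orbT.
by rewrite ih.
Qed.

(** Dominated convergence from positivity and Dini alone. The suprema of the tails of [f] need not
    be continuous, so finite maxima nearly optimal for [L] replace them; running minima of these
    decrease, and Dini makes them uniformly small. *)
Lemma bounded_convergence e : 0 < e -> exists n, L (f n) < e.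
Proof.
move=> e0; apply: contrapT => /forallNP Lf.
have {}Lf n : e <= L (f n) by rewrite leNgt; apply/negP.
pose B' := Num.max B 0.
have wmB n k : L (window_max n k) <= C * B'.
  apply: le_trans (Lcst _); last by rewrite le_max lexx orbT.
  apply: Lle => //; first by move=> x; exact: cvg_cst.
  by move=> x xab; apply: wm_le => m _ _; rewrite le_max fB.
                                                                            
                                                                                 
                                                                          
(* [g n] is a window maximum from n on whose [L]-value is within [dl n] of the supremum over all
   window lengths. Joining a later [g n] to [g m] only gives part of a longer window from m, so it
   raises [L] by at most [dl m]. *)
pose A n := range (fun k => L (window_max n k)).
have Asup n : has_sup (A n).
  split; first by exists (L (window_max n 0)), 0%N.
  by exists (C * B') => _ [k _ <-].
pose dl n := e / 2 ^+ n.+2.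
have dl0 n : 0 < dl n by rewrite divr_gt0// exprn_gt0.
have /choice[k hk] : forall n, exists k, sup (A n) - dl n < L (window_max n k).
  by move=> n; have [_ [k _ <-] ?] := sup_adherent (dl0 n) (Asup n); exists k.
pose g n := window_max n (k n).
have gc n : continuous (g n) by exact: wmc.
have gmax m n : (m <= n)%N ->
    L (fun x => Num.max (g m x) (g n x) - g m x) <= dl m.
  move=> mn; rewrite LB//; last exact: continuous_fun_max.
  suff : L (fun x => Num.max (g m x) (g n x)) <= sup (A m).
    by move=> h; have := hk m; rewrite -/(g m); lra.
  apply: (@le_trans _ _ (L (window_max m (maxn (k m) (n - m + k n))))).
    apply: Lle => //; first exact: continuous_fun_max.
    move=> x _; rewrite ge_max; apply/andP; split; apply: wm_le => j mj jk.
      by apply: wm_ge => //; rewrite (leq_trans jk)// leq_add2l leq_maxl.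
    apply: wm_ge; first exact: leq_trans mj.
    by rewrite (leq_trans jk)// -{1}(subnKC mn) -addnA leq_add2l leq_maxr.
  by apply: ub_le_sup; [exact: (Asup m).2|exists (maxn (k m) (n - m + k n))].
(* [h n] is the minimum of [g 0], ..., [g n]. Passing from [g n] to [h j] loses at most [err n j],
   the sum over i <= j of the excess of [g n] over [g i]. *)
pose h := fix h n x :=
  if n is n'.+1 then Num.min (h n' x) (g n x) else g 0%N x.
have hc n : continuous (h n) by elim: n => //= n ih; apply: continuous_fun_min.
have hg n x : h n x <= g n x by case: n => //= n; rewrite ge_min lexx orbT.
pose err n := fix err j x := if j is j'.+1
  then err j' x + (Num.max (g j x) (g n x) - g j x)
  else Num.max (g 0%N x) (g n x) - g 0%N x.
have tc n j : continuous (fun x => Num.max (g j x) (g n x) - g j x).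
  by move=> x; exact: cvgB (@continuous_fun_max _ _ _ (gc j) (gc n) x) (gc j x).
have ec n j : continuous (err n j).
  elim: j => [|j ih] /=; first exact: tc.
  by move=> x; exact: cvgD (ih x) (tc n j.+1 x).
have t0 n j x : 0 <= Num.max (g j x) (g n x) - g j x.
  by rewrite subr_ge0 le_max lexx.
have e_ge0 n j x : 0 <= err n j x.
  by elim: j => [|j ih] /=; [exact: t0|rewrite addr_ge0].
have ghe n j x : g n x <= h j x + err n j x.
  elim: j => [|j ih] /=; first by rewrite addrC subrK le_max lexx orbT.
  have := t0 n j.+1 x; have := e_ge0 n j x.
  have : g n x <= Num.max (g j.+1 x) (g n x) by rewrite le_max lexx orbT.
  by rewrite [Num.min _ _]minEle; case: ifP => _; lra.
(* The geometric sum of [dl 0], ..., [dl j] equals e/2 - [dl j], because [dl 0] = e/4 and [dl]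
   halves at each step. *)
have Le n j : (j <= n)%N -> L (err n j) <= e / 2 - dl j.
  elim: j => [|j ih] jn /=.
    apply: le_trans (gmax _ _ jn) _; rewrite /dl; lra.
  rewrite LD//; have := ih (ltnW jn); have := gmax _ _ jn.
  have -> : dl j = dl j.+1 + dl j.+1 by rewrite /dl [_ ^+ j.+3]exprS; field; rewrite expf_neq0.
  lra.
(* Chosen so that C [eta] <= e/4 whatever the sign of [C]. Together with the bound e/2 on the error
   this contradicts e <= [L (f n)]. *)
pose eta := e / (4 * (`|C| + 1)).
have C1 : 0 < `|C| + 1 by rewrite ltr_wpDl.
have eta0 : 0 < eta by rewrite divr_gt0// mulr_gt0.
have [||n hn] := @dini _ a b h hc _ _ _ eta0.
- by move=> n x /=; rewrite ge_min lexx.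
- move=> x xab r r0; have r2 : 0 < r / 2 by rewrite divr_gt0.
  have [n nf] := f0 xab r2; exists n.
  apply: le_lt_trans (hg _ _) _; apply: (@le_lt_trans _ _ (r / 2)); last by lra.
  by apply: wm_le => m nm _; exact/ltW/nf.
have Lh : L (h n) <= e / 4.
  apply: (@le_trans _ _ (C * eta)).
    apply: le_trans (Lcst (ltW eta0)); apply: Lle => //.
      by move=> x; exact: cvg_cst.
    by move=> x xab; exact/ltW/hn.
  apply: (@le_trans _ _ ((`|C| + 1) * eta)).
    by rewrite ler_pM2r//; have := ler_norm C; lra.
  by rewrite (_ : _ * eta = e / 4)// /eta; field; rewrite gt_eqF.
have h1 : L (f n) <= L (g n).
  by apply: Lle => // x _; apply: wm_ge; rewrite ?leq_addr.
have h2 : L (g n) <= L (h n) + L (err n n).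
  rewrite -LD//; apply: Lle => // x; by exact: cvgD (hc n x) (ec n n x).
have := Le n n (leqnn n); have := Lf n; have := dl0 n; lra.
Qed.

End bounded_convergence.

                                             

(** * Toeplitz forms and contractive orbits *)

Section quadratic_form.
Context (R : realType).
Implicit Types (r : nat -> nat -> R[i]) (c : nat -> R[i]).

Definition qform r n c : R[i] :=
  \sum_(j < n) \sum_(k < n) c j * (c k)^* * r j k.

Definition toeplitz r := forall j k, r j.+1 k.+1 = r j k.

Lemma toeplitzE r j k s t : toeplitz r -> (j + t = k + s)%N -> r s t = r j k.
Proof.
move=> rT.
have rD m p q : r (m + p)%N (m + q)%N = r p q by elim: m => // m; rewrite !addSn rT.
by move=> jtks; rewrite -(rD j s t) jtks !(addnC _ s) rD.
Qed.

(** Removing the first row and column of a Toeplitz matrix leaves the same matrix one size smaller,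
    which allows induction on n. *)
Lemma qform_recl r n c : toeplitz r -> qform r n.+1 c =
  c 0%N * (c 0%N)^* * r 0%N 0%N
  + (\sum_(k < n) c 0%N * (c k.+1)^* * r 0%N k.+1
     + \sum_(k < n) c k.+1 * (c 0%N)^* * r k.+1 0%N)
  + qform r n (c \o S).
Proof.
move=> rT; rewrite /qform big_ord_recl big_ord_recl /= -!addrA; congr (_ + (_ + _)).
rewrite -big_split /=; apply: eq_bigr => j _.
rewrite big_ord_recl /=; congr (_ + _); apply: eq_bigr => k _.
by rewrite /bump /= !add1n rT.
Qed.

End quadratic_form.

Section contractive_orbit.
Context (R : realType) (V : hilbertType R) (w : nat -> V).
Hypothesis w_contr : forall n (c : nat -> R[i]),
  `|\sum_(k < n) c k *: w k.+1| <= `|\sum_(k < n) c k *: w k|.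

(** The Gram matrix <U^j v, U^k v> that a unitary dilation U would give, with <U^m v, v> = <w_m,
    w_0>; it is in general not the Gram matrix of [w]. *)
Definition correlation j k : R[i] :=
  if (k <= j)%N then hdot (w (j - k)) (w 0%N)
  else (hdot (w (k - j)) (w 0%N))^*.

Lemma hdotC (x y : V) : hdot x y = (hdot y x)^*.
Proof. by rewrite hermC expr0 mul1r. Qed.

Lemma correlation_toeplitz : toeplitz correlation.
Proof. by move=> j k; rewrite /correlation ltnS !subSS. Qed.

                                                                           
                                                                                
                                 
(** Write the sum as c_0 w_0 + y, where y involves only w_1, w_2, ... In the expansion of its square
    norm, the square of c_0 w_0 and the cross terms are exactly the first row and column of the
    form. By contractivity |y| is at most the norm of the same combination with indices lowered by
    one, to which the induction hypothesis applies. *)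
Lemma norm_le_qform n (c : nat -> R[i]) :
  `|\sum_(k < n) c k *: w k| ^+ 2 <= qform correlation n c.
Proof.
elim: n c => [|n ih] c.
  by rewrite /qform !big_ord0 normr0 expr0n.
rewrite (qform_recl _ _ correlation_toeplitz) big_ord_recl.
have -> : \sum_(i < n) c (lift ord0 i) *: w (lift ord0 i) =
  \sum_(i < n) (c \o S) i *: w i.+1 by [].
set x := w 0%N; set y := \sum_(i < n) _ *: _.
have cross : hdot (c 0%N *: x) y =
    \sum_(k < n) c 0%N * (c k.+1)^* * correlation 0 k.+1.
  rewrite /y linear_sumr /=; apply: eq_bigr => k _.
  by rewrite linearZl_LR linearZr_LR /= mulrA /correlation /= subn0 -hdotC.
have crossC : (hdot (c 0%N *: x) y)^* =
    \sum_(k < n) c k.+1 * (c 0%N)^* * correlation k.+1 0.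
  rewrite cross rmorph_sum /=; apply: eq_bigr => k _.
  by rewrite !rmorphM /= conjCK /correlation /= subn0 conjCK [_^* * _]mulrC.
rewrite -hdotE dnormD /= crossC cross addrAC.
rewrite linearZl_LR linearZr_LR /= mulrA {1}/correlation /=.
rewrite lerD2l hdotE (le_trans _ (ih _))// lerXn2r ?nnegrE//.
exact: w_contr.
Qed.

Lemma qform_correlation_ge0 n c : 0 <= qform correlation n c.
Proof. by apply: le_trans (norm_le_qform n c); rewrite exprn_ge0. Qed.

End contractive_orbit.

                    

(** * Roots of unity, Fejer means and the functional of a positive Toeplitz form *)

Section cis.
Context (R : realType).
Implicit Types s t : R.

Definition cis t : R[i] := (cos t +i* sin t)%C.

Lemma cisD s t : cis (s + t) = cis s * cis t.
Proof.
by rewrite /cis cosD sinD [X in (_ +i* X)%C]addrC.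
Qed.

Lemma cis0 : cis 0 = 1.
Proof. by rewrite /cis cos0 sin0. Qed.

Lemma cisN t : cis (- t) = (cis t)^*.
Proof. by rewrite /cis cosN sinN. Qed.

Lemma cisX t n : cis t ^+ n = cis (t *+ n).
Proof.
elim: n => [|n ih]; first by rewrite mulr0n cis0.
by rewrite exprS ih mulrS cisD.
Qed.

Lemma cisJ t : cis t * (cis t)^* = 1.
Proof. by rewrite -cisN -cisD subrr cis0. Qed.

Lemma norm_cis t : `|cis t| = 1.
Proof. by rewrite normc_def /= cos2Dsin2 sqrtr1. Qed.

Lemma cis2pi : cis (pi *+ 2) = 1.
Proof. by rewrite /cis cos2pi sin2pi. Qed.

Lemma cis_neq1 t : 0 < t < pi *+ 2 -> cis t != 1.
Proof.
move=> t2pi; apply/eqP => /(congr1 (@complex.Re R)) /= ct1.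
have : 0 < sin (t / 2) by apply: sin_gt0_pi; rewrite mulr2n in t2pi; lra.
have := cos_mulr2n (t / 2); have := sin2cos2 (t / 2).
rewrite (_ : (t / 2) *+ 2 = t) ?ct1; last by rewrite mulr2n; lra.
rewrite mulr2n; nra.
Qed.

Definition node (M j : nat) : R := pi *+ 2 * j%:R / M%:R.

Lemma node_itv M j : (j < M)%N -> 0 <= node M j <= pi *+ 2.
Proof.
move=> jM; have M0 : 0 < M%:R :> R by rewrite ltr0n; case: M jM.
have p0 : 0 <= pi *+ 2 :> R by rewrite mulrn_wge0// pi_ge0.
rewrite /node divr_ge0 ?mulr_ge0 ?ler0n//= ler_pdivrMr// ler_wpM2l//.
by rewrite ler_nat ltnW.
Qed.

(** Orthogonality of characters on the M-th roots of unity: off the diagonal this is a geometric sum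
    whose ratio x satisfies x^M = 1 and x != 1, the latter because |p - q| < M. *)
Lemma sum_cis_node M p q : (p < M)%N -> (q < M)%N ->
  \sum_(j < M) cis (node M j) ^+ p * (cis (node M j) ^+ q)^*
  = (M * (p == q))%:R.
Proof.
move=> pM qM; have M0 : (M%:R : R) != 0 by rewrite pnatr_eq0; case: M pM qM.
have [<-|pq] := eqVneq p q.
  under eq_bigr do rewrite rmorphXn -exprMn /= cisJ expr1n.
  by rewrite sumr_const card_ord muln1.
pose x : R[i] := cis (node M 1) ^+ p * (cis (node M 1) ^+ q)^*.
have nodeM j : cis (node M j) = cis (node M 1) ^+ j.
  by rewrite cisX; congr cis; rewrite /node mulr1 -mulr_natr; field.
have -> : \sum_(j < M) cis (node M j) ^+ p * (cis (node M j) ^+ q)^*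
    = \sum_(j < M) x ^+ j.
  apply: eq_bigr => j _; rewrite nodeM /x !rmorphXn exprMn /=.
  by rewrite -!exprM ![(_ * j)%N]mulnC.
have xM : x ^+ M = 1.
  rewrite /x exprMn -rmorphXn -!exprM ![(_ * M)%N]mulnC !exprM.
  rewrite [cis _ ^+ M]cisX (_ : _ *+ M = pi *+ 2) ?cis2pi ?expr1n ?rmorph1 ?mulr1//.
  by rewrite /node -mulr_natr; field.
have x1 : x != 1.
  have cis_lt m n : (m < n)%N -> (n < M)%N ->
      cis (node M 1) ^+ n * (cis (node M 1) ^+ m)^* != 1.
    move=> mn nM; rewrite !cisX -cisN -cisD -mulrnBr; last exact: ltnW.
    apply: cis_neq1; rewrite /node mulr1 -[X in _ < X < _]mulr_natr.
    have M_gt0 : 0 < M%:R :> R by rewrite ltr0n; exact: leq_trans nM.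
    have p0 : 0 < pi *+ 2 :> R by rewrite pmulrn_lgt0// pi_gt0.
    rewrite !mulr_gt0 ?invr_gt0 ?ltr0n ?subn_gt0 ?mn ?(leq_trans _ nM)//=.
    rewrite mulrAC ltr_pdivrMr// ltr_pM2l// ltr_nat.
    by rewrite (leq_ltn_trans _ nM)// leq_subr.
  move: pq; rewrite neq_ltn => /orP[pq|qp]; last exact: cis_lt.
  apply/eqP => /(congr1 Num.conj); rewrite /x rmorphM rmorph1 /= conjCK mulrC.
  exact/eqP/cis_lt.
rewrite muln0; apply/eqP; have := subrX1 x M; rewrite xM subrr => /esym/eqP.
by rewrite mulf_eq0 subr_eq0 (negbTE x1).
Qed.

End cis.

Section lattice_count.

(** The multiplicity with which the entry [r j k] survives when |p|^2 times a Fejer mean is averaged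
    over the circle; it is N up to an error of j + k. *)
Definition diag_count N j k := (\sum_(s < N) \sum_(t < N) (j + t == k + s))%N.

Lemma diag_count_le N j k : (diag_count N j k <= N)%N.
Proof.
rewrite -[X in (_ <= X)%N]card_ord -sum1_card; apply: leq_sum => s _.
have [[t jt]|H] := pselect (exists t : 'I_N, (j + t == k + s)%N).
  rewrite (bigD1 t)//= jt big1 ?addn0// => u /negP ut.
  apply/eqP; rewrite eqb0; apply/negP => /eqP ju; apply: ut.
  by apply/eqP/val_inj/(@addnI j); rewrite ju (eqP jt).
by rewrite big1// => t _; apply/eqP; rewrite eqb0; apply/negP => jt; apply: H; exists t.
Qed.

Lemma diag_count_ge N j k : (N <= diag_count N j k + (j + k))%N.
Proof.
have lt_sum M : (\sum_(s < N) (s < M) <= M)%N.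
  suff -> : (\sum_(s < N) (s < M) = minn N M)%N by lia.
  elim: N => [|m ih]; first by rewrite big_ord0 min0n.
  by rewrite big_ord_recr /= ih; case: ltnP; lia.
have := lt_sum j; have := lt_sum k.
rewrite [X in (X <= k)%N -> _](reindex_inj rev_ord_inj) /= => hk hj.
(* Each s has the partner t = k + s - j in range, unless it is one of the first j or of the last k
   indices. *)
suff : (N <= \sum_(s < N) ((\sum_(t < N) (j + t == k + s)) + ((s < j) + (N - s.+1 < k))))%N.
  by rewrite !big_split /= => /leq_trans; apply; rewrite leq_add2l leq_add.
rewrite -[X in (X <= _)%N]card_ord -sum1_card; apply: leq_sum => s _.
have [//|sj] := ltnP s j; first by rewrite addnC.
have [//|sk] := ltnP (N - s.+1) k; first by rewrite !addnA addnC.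
have tN : (k + s - j < N)%N by have := ltn_ord s; lia.
rewrite (bigD1 (Ordinal tN))//= subnKC ?eqxx//; lia.
Qed.

End lattice_count.

Section fejer.
Context (R : realType) (r : nat -> nat -> R[i]).
Hypothesis r_toeplitz : toeplitz r.
Hypothesis r_ge0 : forall n c, 0 <= qform r n c.

Definition trigpoly n (c : nat -> R[i]) (t : R) : R[i] :=
  \sum_(k < n) c k * cis t ^+ k.

Definition sqnorm (z : R[i]) : R := complex.Re z ^+ 2 + complex.Im z ^+ 2.

(** The N-th Fejer mean of the Fourier series whose coefficients are the diagonals of [r]; written
    as a value of the form, it is visibly nonnegative. *)
Definition fejer N (t : R) : R[i] :=
  N%:R^-1 * qform r N (fun k => (cis t ^+ k)^*).

Lemma sqnormE z : (sqnorm z)%:C%C = z * z^*.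
Proof. by rewrite /sqnorm add_Re2_Im2 sqr_normc. Qed.

Lemma ge0_ReE (z : R[i]) : 0 <= z -> (complex.Re z)%:C%C = z.
Proof. by case: z => a b; rewrite lecE /= => /andP[/eqP -> _]. Qed.

Lemma fejer_ge0 N t : 0 <= fejer N t.
Proof. by rewrite mulr_ge0// invr_ge0 ler0n. Qed.

(** All exponents that occur are below n + N <= M, so averaging over the M nodes is exact. Only
    terms with j + t = k + s survive, and for these [r s t] = [r j k] by the Toeplitz property. *)
Lemma fejer_mean n c N M : (0 < N)%N -> (n + N <= M)%N ->
  M%:R^-1 * \sum_(i < M)
     (sqnorm (trigpoly n c (node R M i)))%:C%C * fejer N (node R M i) =
  \sum_(j < n) \sum_(k < n) c j * (c k)^* * r j k *
     ((diag_count N j k)%:R / N%:R).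
Proof.
move=> N0 nNM; have M0 : M%:R != 0 :> R[i] by rewrite pnatr_eq0; lia.
apply: (mulfI M0); rewrite mulVKf//.
pose z i := cis (node R M i).
transitivity (\sum_(i < M) \sum_(j < n) \sum_(k < n) \sum_(s < N) \sum_(t < N)
    (c j * (c k)^* * r s t / N%:R) * (z i ^+ (j + t)%N * (z i ^+ (k + s)%N)^*)).
  apply: eq_bigr => i _; rewrite sqnormE /fejer /qform /trigpoly rmorph_sum.
  rewrite mulr_suml mulr_suml; apply: eq_bigr => j _.
  rewrite mulr_sumr mulr_suml; apply: eq_bigr => k _.
  rewrite !mulr_sumr; apply: eq_bigr => s _.
  rewrite !mulr_sumr; apply: eq_bigr => t _.
  rewrite conjCK !rmorphM /= !exprD rmorphM /= -!/(z _); ring.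
rewrite mulr_sumr exchange_big; apply: eq_bigr => j _ /=.
rewrite mulr_sumr exchange_big; apply: eq_bigr => k _ /=.
rewrite exchange_big /=.
transitivity (\sum_(s < N) \sum_(t < N)
   c j * (c k)^* * r j k / N%:R * (M * (j + t == k + s))%N%:R : R[i]).
  apply: eq_bigr => s _; rewrite exchange_big; apply: eq_bigr => t _ /=.
  rewrite -mulr_sumr sum_cis_node; first last.
  - by have := ltn_ord k; have := ltn_ord s; lia.
  - by have := ltn_ord j; have := ltn_ord t; lia.
  have [jtks|_] := eqVneq (j + t)%N (k + s)%N; last by rewrite muln0 !mulr0.
  by rewrite (toeplitzE r_toeplitz jtks).
rewrite /diag_count natr_sum mulr_suml !mulr_sumr; apply: eq_bigr => s _.
rewrite natr_sum mulr_suml !mulr_sumr; apply: eq_bigr => t _.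
by rewrite natrM; ring.
Qed.

Lemma diag_count_cvg j k :
  (diag_count N.+1 j k)%:R / N.+1%:R @[N --> \oo] --> (1 : R).
Proof.
apply: (@squeeze_cvgr _ _ _ _ (fun N => 1 - (j + k)%:R * harmonic N) (fun=> 1)).
- apply: nearW => N; rewrite /harmonic /= ler_pdivrMr ?ltr0n// mul1r ler_nat.
  rewrite diag_count_le andbT ler_pdivlMr ?ltr0n// mulrBl mulfVK ?pnatr_eq0//.
  by rewrite mul1r lerBlDr -natrD ler_nat diag_count_ge.
- rewrite -[X in _ --> X]subr0 -[X in _ - X](mulr0 (j + k)%:R).
  apply: cvgB; first exact: cvg_cst.
  by apply: cvgMl_tmp; exact: cvg_harmonic.
- exact: cvg_cst.
Qed.

                                                                               
                                                                
(** A Riemann sum for the integral of [g] against the Fejer mean. With 2(N+1) nodes it is exact on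
    |p|^2 once p has at most N+1 coefficients. *)
Definition circle_mean N (g : R -> R) : R :=
  let M := (N.+1 + N.+1)%N in
  M%:R^-1 * \sum_(i < M) g (node R M i) * complex.Re (fejer N.+1 (node R M i)).

Lemma circle_mean_sqnorm n c N : (n <= N.+1)%N ->
  (circle_mean N (fun t => sqnorm (trigpoly n c t)))%:C%C =
  \sum_(j < n) \sum_(k < n) c j * (c k)^* * r j k *
     ((diag_count N.+1 j k)%:R / N.+1%:R).
Proof.
move=> nN; have nM : (n + N.+1 <= N.+1 + N.+1)%N by rewrite leq_add2r.
rewrite -(fejer_mean c _ nM)// rmorphM fmorphV rmorph_nat rmorph_sum.
congr (_ * _); apply: eq_bigr => i _; rewrite rmorphM; congr (_ * _).
exact/ge0_ReE/fejer_ge0.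
Qed.

Lemma circle_mean_cvg n c :
  circle_mean N (fun t => sqnorm (trigpoly n c t)) @[N --> \oo]
    --> complex.Re (qform r n c).
Proof.
have ReM (x : R[i]) (a b : nat) : complex.Re (x * (a%:R / b%:R)) =
    complex.Re x * (a%:R / b%:R).
  have -> : a%:R / b%:R = (a%:R / b%:R : R)%:C%C.
    by rewrite rmorphM fmorphV !rmorph_nat.
  by case: x => x y /=; rewrite mulr0 subr0.
have Re_sum m (F : 'I_m -> R[i]) :
    complex.Re (\sum_i F i) = \sum_i complex.Re (F i).
  by apply: (big_morph (@complex.Re R)) => // -[? ?] [].
pose term j k : R := complex.Re (c j * (c k)^* * r j k).
have -> : complex.Re (qform r n c) = \sum_(j < n) \sum_(k < n) term j k * 1.
  rewrite /qform Re_sum; apply: eq_bigr => j _; rewrite Re_sum.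
  by apply: eq_bigr => k _; rewrite mulr1.
apply: (@cvg_trans _ ((fun N => \sum_(j < n) \sum_(k < n) term j k *
     ((diag_count N.+1 j k)%:R / N.+1%:R)) @ \oo)); last first.
  apply: cvg_big => [|j _]; first exact: add_continuous.
  apply: cvg_big => [|k _]; first exact: add_continuous.
  by apply: cvgMl_tmp; exact: diag_count_cvg.
apply: near_eq_cvg; exists n => // N /= nN.
have := circle_mean_sqnorm c (leqW nN) => /(congr1 (@complex.Re R)) /= ->.
rewrite Re_sum; apply: eq_bigr => j _; rewrite Re_sum.
by apply: eq_bigr => k _; rewrite ReM.
Qed.

Lemma circle_meanD N (g h : R -> R) : circle_mean N (fun t => g t + h t) =
  circle_mean N g + circle_mean N h.
Proof.
rewrite /circle_mean -mulrDr -big_split /=; congr (_ * _).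
by apply: eq_bigr => i _; rewrite mulrDl.
Qed.

Lemma circle_meanZ N s (g : R -> R) :
  circle_mean N (fun t => s * g t) = s * circle_mean N g.
Proof.
rewrite /circle_mean mulrCA; congr (_ * _); rewrite mulr_sumr.
by apply: eq_bigr => i _; rewrite mulrA.
Qed.

Lemma circle_mean_le N (g h : R -> R) :
  (forall t, 0 <= t <= pi *+ 2 -> g t <= h t) ->
  circle_mean N g <= circle_mean N h.
Proof.
move=> gh; rewrite /circle_mean ler_wpM2l ?invr_ge0 ?ler0n//.
apply: ler_sum => i _; rewrite ler_wpM2r ?gh ?node_itv//.
by rewrite -(@lecR R) ge0_ReE fejer_ge0.
Qed.

Lemma circle_mean1_cvg :
  circle_mean N (fun=> 1) @[N --> \oo] --> complex.Re (r 0%N 0%N).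
Proof.
have trig1 : (fun t => sqnorm (trigpoly 1 (fun=> 1) t)) = (fun=> 1).
  apply/funext => t; rewrite /trigpoly big_ord1 expr0 mulr1 /sqnorm /=.
  by rewrite expr0n expr1n addr0.
have := @circle_mean_cvg 1 (fun=> 1); rewrite trig1.
by rewrite /qform !big_ord1 rmorph1 !mul1r.
Qed.

(** By positivity the means are at most max |g| times the means of 1, and the latter converge. *)
Lemma circle_mean_bounded (g : R -> R) : continuous g ->
  bounded_seq (circle_mean ^~ g).
Proof.
move=> gc; have p0 : 0 <= pi *+ 2 :> R by rewrite mulrn_wge0// pi_ge0.
have ngc : {within `[0, pi *+ 2], continuous (fun t => `|g t|)}.
  by apply: continuous_subspaceT => t; apply: cvg_norm; exact: gc.
have [x _ gx] := EVT_max p0 ngc.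
have [C C1] : bounded_seq (circle_mean ^~ (fun=> 1)).
  have /(@cvgP _ _ _)/cvg_seq_bounded[K [_ hK]] := circle_mean1_cvg.
  by exists (K + 1) => N; apply: (hK (K + 1)) => //; rewrite ltrDl.
exists (`|g x| * C) => N.
apply: (@le_trans _ _ (circle_mean N (fun=> `|g x|))).
  rewrite ler_norml lerNl -mulN1r -circle_meanZ; apply/andP; split.
    apply: circle_mean_le => t t02; rewrite mulN1r.
    by rewrite (le_trans (ler_norm _))// normrN gx// in_itv.
  apply: circle_mean_le => t t02; apply: le_trans (ler_norm _) (gx _ _).
  by rewrite in_itv.
rewrite -[X in circle_mean _ X](_ : (fun=> `|g x| * 1) = _); last first.
  by apply/funext => t; rewrite mulr1.
by rewrite circle_meanZ ler_wpM2l// (le_trans _ (C1 N))// ler_norm.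
Qed.

Lemma continuous_sqnorm_trigpoly n c :
  continuous (fun t => sqnorm (trigpoly n c t)).
Proof.
have cont k : continuous (fun t : R => cos (t *+ k)) /\
    continuous (fun t : R => sin (t *+ k)).
  have km : continuous (fun t : R => t *+ k).
    by move=> t; under eq_fun do rewrite -mulr_natr; exact: mulrr_continuous.
  by split=> t; apply: (continuous_comp (km t));
    [exact: continuous_cos|exact: continuous_sin].
rewrite /trigpoly /sqnorm.
have : continuous (fun t => complex.Re (\sum_(k < n) c k * cis t ^+ k)) /\
       continuous (fun t => complex.Im (\sum_(k < n) c k * cis t ^+ k)).
  elim: n => [|n [ihr ihi]].
    by split=> t; under eq_fun do rewrite big_ord0; exact: cvg_cst.
  have [ck sk] := cont n.
  split=> t.
    rewrite (_ : (fun _ => _) = fun t => complex.Re (\sum_(k < n) c k * cis t ^+ k) +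
      (complex.Re (c n) * cos (t *+ n) - complex.Im (c n) * sin (t *+ n))).
      apply: cvgD; first exact: ihr.
      by apply: cvgB; apply: cvgMl_tmp; [exact: ck|exact: sk].
    apply/funext => s; rewrite big_ord_recr /= cisX.
    by case: (\sum_(i < n) _) (c n) => ? ? [].
  rewrite (_ : (fun _ => _) = fun t => complex.Im (\sum_(k < n) c k * cis t ^+ k) +
    (complex.Re (c n) * sin (t *+ n) + complex.Im (c n) * cos (t *+ n))).
    apply: cvgD; first exact: ihi.
    by apply: cvgD; apply: cvgMl_tmp; [exact: sk|exact: ck].
  apply/funext => s; rewrite big_ord_recr /= cisX.
  by case: (\sum_(i < n) _) (c n) => ? ? [].
by move=> [cr ci] t; apply: cvgD; rewrite /=; apply: cvgM;
  [exact: cr|exact: cr|exact: ci|exact: ci].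
Qed.

(** [bounded_convergence] for the generalized limit of the circle means. On the squares |p|^2 the
    means converge, so there the functional is the value of the form. *)
Lemma qform_lt (n : nat -> nat) (c : nat -> nat -> R[i]) (B e : R) :
  (forall i t, sqnorm (trigpoly (n i) (c i) t) <= B) ->
  (forall t, sqnorm (trigpoly (n i) (c i) t) @[i --> \oo] --> (0 : R)) ->
  0 < e -> exists i, complex.Re (qform r (n i) (c i)) < e.
Proof.
move=> cB c0 e0; have [L [LD Lle Lcvg]] := @generalized_limit R.
pose f i t := sqnorm (trigpoly (n i) (c i) t).
have [||||||i] := @bounded_convergence R 0 (pi *+ 2)
    (complex.Re (r 0%N 0%N)) B (fun g => L (circle_mean ^~ g)) _ _ _ f _ _ _ e e0.
- move=> g h gc hc; rewrite -LD; [|exact: circle_mean_bounded..].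
  by congr L; apply/funext => N; rewrite circle_meanD.
- move=> g h gc hc gh; apply: Lle; [exact: circle_mean_bounded..|].
  by move=> N; exact: circle_mean_le.
- move=> s s0; rewrite (Lcvg _ (complex.Re (r 0%N 0%N) * s))//.
  rewrite (_ : circle_mean ^~ _ = (fun N => circle_mean N (fun=> 1) * s)).
    by apply: cvgMr_tmp; exact: circle_mean1_cvg.
  by apply/funext => N; rewrite mulrC -circle_meanZ mulr1.
- by move=> i; exact: continuous_sqnorm_trigpoly.
- by move=> i t _; exact: cB.
- move=> t s _ s0; have /(cvgr_lt _)/(_ _ s0)[k _ hk] := c0 t.
  by exists k => m km; exact: hk.
- by rewrite (Lcvg _ _ (@circle_mean_cvg (n i) (c i))) => ie; exists i.
Qed.

End fejer.

                                              

(** * Convergence of modulated averages in one Hilbert space *)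

Section hilbert_modulated_average.
Context (R : realType).
Implicit Type a : nat -> R[i].

Definition average (V : lmodType R[i]) a (x : nat -> V) n : V :=
  n%:R^-1 *: \sum_(k < n) a k *: x k.

(** Extended by zero from n on, so that averages of different lengths become sums over a common
    range. *)
Definition average_coef a n k : R[i] := (k < n)%:R * (a k / n%:R).

Lemma sum_average_coef (V : lmodType R[i]) a (x : nat -> V) n m : (n <= m)%N ->
  \sum_(k < m) average_coef a n k *: x k = average a x n.
Proof.
move=> nm; rewrite /average scaler_sumr (big_ord_widen _ (fun k => n%:R^-1 *: (a k *: x k)) nm) /=.
rewrite [RHS]big_mkcond; apply: eq_bigr => k _; rewrite /average_coef.
by case: ifP => _; rewrite ?mul0r ?scale0r// mul1r scalerA mulrC.
Qed.

Lemma sum_average_coefB (V : lmodType R[i]) a (x : nat -> V) n m :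
  \sum_(k < maxn n m) (average_coef a n k - average_coef a m k) *: x k =
  average a x n - average a x m.
Proof.
under eq_bigr do rewrite scalerBl.
by rewrite sumrB !sum_average_coef ?leq_maxl ?leq_maxr.
Qed.

Context (a : nat -> R[i]).
Hypothesis a_cvg : forall l : R[i], `|l| = 1 -> exists c : R[i],
  (n%:R^-1 * \sum_(k < n) a k * (l^*) ^+ k : R[i]^o) @[n --> \oo] --> (c : R[i]^o).
Hypothesis a_bounded : exists M : R, forall n : nat, (0 < n)%N ->
  forall l : R[i], `|l| = 1 ->
  `|n%:R^-1 * \sum_(k < n) a k * l ^+ k| <= M%:C%C.

Context (V : hilbertType R) (w : nat -> V).
Hypothesis w_contr : forall n (c : nat -> R[i]),
  `|\sum_(k < n) c k *: w k.+1| <= `|\sum_(k < n) c k *: w k|.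

(** Otherwise there are indices [n i], [m i] beyond every i whose averages stay apart. The
    polynomials with coefficients [d i] are then bounded by 2M and tend to 0 at every point of the
    circle, so [qform_lt] makes some value of the form smaller than e, against [norm_le_qform]. *)
Lemma average_cauchy (e : R) : 0 < e -> exists N, forall n m,
  (N <= n)%N -> (N <= m)%N -> `|average a w n - average a w m| ^+ 2 < e%:C%C.
Proof.
move=> e0; apply: contrapT => /forallNP H.
have /choice[nm hnm] : forall i, exists nm : nat * nat,
    [/\ (i < nm.1)%N, (i < nm.2)%N &
     ~~ (`|average a w nm.1 - average a w nm.2| ^+ 2 < e%:C%C)].
  move=> i; apply: contrapT => /forallNP Hi; apply: (H i.+1) => n m ni mi.
  by apply: contrapT => /negP ?; exact: (Hi (n, m)).
pose n i := (nm i).1; pose m i := (nm i).2.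
pose len i := maxn (n i) (m i).
pose d i k := average_coef a (n i) k - average_coef a (m i) k.
pose x t k : R[i]^o := cis t ^+ k.
have trigE i t : trigpoly (len i) (d i) t = average a (x t) (n i) - average a (x t) (m i).
  exact: (@sum_average_coefB R[i]^o a (x t) (n i) (m i)).
have [M hM] := a_bounded.
have avgM t k : (0 < k)%N -> `|average a (x t) k| <= M%:C%C.
  by move=> k0; exact: hM k0 _ (norm_cis t).
have corr_ge0 := qform_correlation_ge0 w_contr.
have [||i] := @qform_lt R (correlation w) (@correlation_toeplitz _ _ w)
  corr_ge0 len d ((M + M) ^+ 2) e _ _ e0.
- move=> i t; rewrite -lecR sqnormE -sqr_normc rmorphXn rmorphD /=.
  have [ni mi _] := hnm i; have := avgM t (n i) (leq_ltn_trans (leq0n _) ni).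
  have := avgM t (m i) (leq_ltn_trans (leq0n _) mi) => hm hn.
  rewrite lerXn2r ?nnegrE ?trigE//; first by rewrite (le_trans _ (lerD hn hm)).
  by rewrite (le_trans (ler_normB _ _))// lerD.
- move=> t; have [c hc] : exists c : R[i], average a (x t) k @[k --> \oo] --> (c : R[i]^o).
    have [|c hc] := a_cvg (l := (cis t)^*); first by rewrite norm_conjC norm_cis.
    by exists c; move: hc; rewrite conjCK.
  have n_oo : n i @[i --> \oo] --> \oo.
    apply/cvgnyPge => A; exists A => // i /= Ai.
    by have [ni _ _] := hnm i; exact: leq_trans Ai (ltnW ni).
  have m_oo : m i @[i --> \oo] --> \oo.
    apply/cvgnyPge => A; exists A => // i /= Ai.
    by have [_ mi _] := hnm i; exact: leq_trans Ai (ltnW mi).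
  have hn := cvg_comp _ _ n_oo hc.
  have hm := cvg_comp _ _ m_oo hc.
  have h0 : average a (x t) (n i) - average a (x t) (m i) @[i --> \oo] -->
      (0 : R[i]^o) by rewrite -(subrr c); exact: cvgB hn hm.
  (* The cap at 1 lets a bound on the modulus serve for its square: min(s, 1)^2 <= min(s, 1) <=
     s. *)
  apply/cvgrPdist_lt => s s0; have s1 : 0 < Num.min s 1 by rewrite lt_min s0 ltr01.
  have s1C : 0 < (Num.min s 1)%:C%C :> R[i] by rewrite ltcR.
  have [K _ hK] := (@cvgrPdist_lt _ R[i]^o _ _ _ _ _).1 h0 _ s1C.
  exists K => // i /= /hK; rewrite /= !sub0r !normrN -trigE => hi.
  rewrite -ltcR (_ : `|_|%:C%C = `|trigpoly (len i) (d i) t| ^+ 2); last first.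
    by rewrite ger0_norm ?sqnormE ?sqr_normc// /sqnorm addr_ge0// sqr_ge0.
  apply: (@lt_le_trans _ _ ((Num.min s 1)%:C%C ^+ 2)).
    by rewrite ltrXn2r// ?nnegrE// ltW.
  rewrite -rmorphXn lecR expr2 (@le_trans _ _ (Num.min s 1))//.
    by rewrite ler_piMl ?ge_min ?lexx ?orbT// ltW.
  by rewrite ge_min lexx.
- have [_ _ /negP Hi] := hnm i => ie; apply: Hi.
  rewrite -(sum_average_coefB a w (n i) (m i)).
  apply: (le_lt_trans (norm_le_qform w_contr _ (d i))).
  by rewrite -(ge0_ReE (corr_ge0 _ _)) ltcR.
Qed.

Lemma average_cvg : cvg (average a w n @[n --> \oo]).
Proof.
apply/cauchy_cvgP/cauchy_exP => e e0.
have e'0 : 0 < complex.Re e by rewrite -ltcR ge0_ReE// ltW.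
have [N hN] := average_cauchy (exprn_gt0 2 e'0).
exists (average a w N), N => // n /= Nn.
rewrite -ball_normE /= -(@ltr_pXn2r _ 2)// ?nnegrE// ?ltW//.
by rewrite -[e]ge0_ReE ?ltW// -rmorphXn; exact: hN.
Qed.

End hilbert_modulated_average.

                              

(** * From a contraction over [L0] to contractive orbits in almost every fibre *)

Section rational_coefficients.
Context (R : realType).

Definition complex_of_rat (q : rat * rat) : R[i] := (ratr q.1 +i* ratr q.2)%C.

Lemma complex_of_rat_dense (z : R[i]) (e : R) : 0 < e ->
  exists q, `|z - complex_of_rat q| < e%:C%C.
Proof.
move=> e0; case: z => a b.
have near_rat (x : R) : exists q : rat, `|x - ratr q| < e / 2.
  have [|q] := @rat_in_itvoo _ (x - e / 2) (x + e / 2); first by lra.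
  rewrite in_itv /= => h; exists q; rewrite ltr_distlC; lra.
have [p hp] := near_rat a; have [q hq] := near_rat b; exists (p, q).
have -> : (a +i* b)%C - complex_of_rat (p, q) =
    (a - ratr p)%:C%C + (b - ratr q)%:C%C * 'i%C.
  by rewrite /complex_of_rat; simpc.
apply: le_lt_trans (ler_normD _ _) _; rewrite normrM.
rewrite !normc_def /= !expr0n /= expr1n !(addr0, add0r) sqrtr1 mulr1.
by rewrite !sqrtr_sqr -rmorphD ltcR; lra.
Qed.

(** Both sides are continuous in the coefficients. Restricting to a countable set of them keeps the
    union of the exceptional null sets null. *)
Lemma le_norm_sum_rat (V : normedModType R[i]) n (x y : nat -> V) :
  (forall q : nat -> rat * rat, `|\sum_(k < n) complex_of_rat (q k) *: y k|
    <= `|\sum_(k < n) complex_of_rat (q k) *: x k|) ->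
  forall c : nat -> R[i],
    `|\sum_(k < n) c k *: y k| <= `|\sum_(k < n) c k *: x k|.
Proof.
move=> h c.
have nE (v : V) : `|v| = (complex.Re `|v|)%:C%C by rewrite ge0_ReE.
have n0 (v : V) : 0 <= complex.Re `|v| by rewrite -(@lecR R) -nE; exact: normr_ge0.
rewrite [leLHS]nE [leRHS]nE lecR; apply/ler_addgt0Pr => e e0.
pose s := \sum_(k < n) (complex.Re `|x k| + complex.Re `|y k|).
have s0 : 0 <= s by apply: sumr_ge0 => k _; rewrite addr_ge0.
pose dl := e / (s + 1).
have dl0 : 0 < dl by rewrite divr_gt0// ltr_wpDl.
have /choice[q hq] : forall k, exists q, `|c k - complex_of_rat q| < dl%:C%C.
  by move=> k; exact: complex_of_rat_dense.
have bound (v : nat -> V) :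
    `|\sum_(k < n) c k *: v k - \sum_(k < n) complex_of_rat (q k) *: v k|
    <= (\sum_(k < n) dl * complex.Re `|v k|)%:C%C.
  rewrite -sumrB (le_trans (ler_norm_sum _ _ _))// rmorph_sum ler_sum// => k _.
  by rewrite -scalerBl normrZ rmorphM /= -nE ler_wpM2r// ltW.
rewrite -lecR rmorphD /= -!nE.
have hx := bound x; have hy := bound y; have {}h := h q.
set Y := \sum_(k < n) c k *: y k in hy *.
set X := \sum_(k < n) c k *: x k in hx *.
set Y' := \sum_(k < n) _ *: y k in hy h.
set X' := \sum_(k < n) _ *: x k in hx h.
have {}hy : `|Y| <= `|Y'| + (\sum_(k < n) dl * complex.Re `|y k|)%:C%C.
  by rewrite -[in leLHS](subrK Y' Y) addrC (le_trans (ler_normD _ _))// lerD2l.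
have {}hx : `|X'| <= `|X| + (\sum_(k < n) dl * complex.Re `|x k|)%:C%C.
  by rewrite -[in leLHS](subrK X X') addrC (le_trans (ler_normD _ _))// lerD2l distrC.
apply: (le_trans hy); apply: (le_trans (lerD (le_trans h hx) (lexx _))).
rewrite -addrA lerD2l -rmorphD lecR -big_split /=.
under eq_bigr do rewrite -mulrDr.
rewrite -mulr_sumr -/s /dl mulrAC ler_pdivrMr ?ltr_wpDl// ler_pM2l// lerDl//.
Qed.

End rational_coefficients.

Section ae_countable.
Context d (T : measurableType d) (R : realType) (mu : {measure set T -> \bar R}).

Lemma ae_forall_countable (I : countType) (P : I -> T -> Prop) :
  (forall i, {ae mu, forall x, P i x}) -> {ae mu, forall x, forall i, P i x}.
Proof.
move=> h; have /ae_foralln : forall n,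
    {ae mu, forall x, forall i, pickle i = n -> P i x}.
  move=> n; have [[i ni]|Hn] := pselect (exists i : I, pickle i = n).
    apply: filterS (h i) => x Pi j jn.
    by have -> : j = i by apply: (pcan_inj pickleK); rewrite jn ni.
  by apply: aeW => x i ni; case: Hn; exists i.
by apply: filterS => x H i; exact: H.
Qed.

End ae_countable.

Lemma L0H_val_sum d (T : measurableType d) (R : realType)
    (mu : {measure set T -> \bar R}) (E : hilbert_bundle mu)
    (v : nat -> L0H E) n (c : nat -> R[i]) : {ae mu, forall x,
  L0H_val (\sum_(k < n) L0_cst mu (c k) *: v k) x =
  \sum_(k < n) c k *: L0H_val (v k) x}.
Proof.
elim: n => [|n ih].
  by apply: filterS (L0H_zeroE E) => x; rewrite !big_ord0.
have -> : \sum_(k < n.+1) L0_cst mu (c k) *: v k =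
  \sum_(k < n) L0_cst mu (c k) *: v k + L0_cst mu (c n) *: v n.
  by rewrite big_ord_recr.
apply: filter_app (L0H_addE (\sum_(k < n) L0_cst mu (c k) *: v k)
  (L0_cst mu (c n) *: v n)).
apply: filter_app (L0H_scaleE (L0_cst mu (c n)) (v n)).
apply: filter_app (L0_cstE mu (c n)); apply: filterS ih => x ih cE sE aE.
by rewrite [LHS]aE sE cE ih big_ord_recr.
Qed.

Lemma L0_Re_measurable d (T : measurableType d) (R : realType)
    (mu : {measure set T -> \bar R}) (f : L0 mu) :
  measurable_fun setT (fun x => complex.Re (f x)).
Proof. by have /measurable_fun_complexP[] := @L0_measurable _ _ _ _ f. Qed.

Section contraction.
Context d (T : measurableType d) (R : realType) (mu : {measure set T -> \bar R}).
Context (cmu : measure_is_complete mu) (E : hilbert_bundle mu).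
Context (S : {linear L0H E -> L0H E}) (hS : L0_contraction cmu S).

Lemma contraction_norm_le (u : L0H E) : L0H_norm cmu u <= 1 ->
  L0H_norm cmu (S u) <= 1.
Proof.
have [_ [N [N_ub _] N1]] := hS => u1; apply: le_trans N1.
by apply: N_ub; exists u.
Qed.

(** Test [S] on a u, where a is 1/q times the indicator of the set where |u| <= q. Then |a u| <= 1,
    hence |a| |S u| = |S (a u)| <= 1, which reads |S u| <= q on that set. *)
Lemma contraction_pointwise_bound (u : L0H E) (q : rat) : 0 < q ->
  {ae mu, forall x, `|L0H_val u x| <= (ratr q)%:C%C ->
    `|L0H_val (S u) x| <= (ratr q)%:C%C}.
Proof.
move=> q0; pose nu x := complex.Re (L0H_norm cmu u x).
have q0R : 0 < ratr q :> R by rewrite ltr0q.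
have q0C : 0 < (ratr q)%:C%C :> R[i] by rewrite ltcR.
have mnu : measurable_fun setT nu.
  exact: L0_Re_measurable.
pose A := [set x | nu x <= ratr q].
have mA : measurable A.
  rewrite -[A]setTI; exact: measurable_fun_le.
have ma : measurable_fun setT (fun x => ((ratr q)^-1 * \1_A x)%:C%C : R[i]).
  apply/measurable_fun_complexP; split => //=.
  by apply: measurable_funM => //; exact: measurable_indic.
pose a := L0_mk mu ma.
have au1 : L0H_norm cmu (a *: u) <= 1.
  apply/L0_leP; apply: filter_app (L0H_normE cmu (a *: u)).
  apply: filter_app (L0H_scaleE a u); apply: filter_app (L0_mkE mu ma).
  apply: filter_app (L0H_normE cmu u); apply: filter_app (L0_cstE mu 1).
  apply: aeW => x -> un aE auE ->; rewrite auE normrZ aE indicE.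
  have [|_] := boolP (x \in A); last by rewrite mulr0 normr0 mul0r ler01.
  rewrite inE /A /= /nu un mulr1 -(@lecR R) ge0_ReE// => uq.
  rewrite ger0_norm; last by rewrite lecR invr_ge0 ltW.
  by rewrite rmorphV ?unitfE ?gt_eqF// -(ler_pM2l q0C) mulVKf ?gt_eqF// mulr1.
have /L0_leP := contraction_norm_le au1; rewrite linearZ /=.
apply: filter_app; apply: filter_app (L0H_normE cmu (a *: S u)).
apply: filter_app (L0H_scaleE a (S u)); apply: filter_app (L0_mkE mu ma).
apply: filter_app (L0H_normE cmu u); apply: filter_app (L0_cstE mu 1).
apply: aeW => x -> un aE auE ->; rewrite auE normrZ aE indicE => h uq.
have xA : x \in A by rewrite inE /A /= /nu un -(@lecR R) ge0_ReE.
move: h; rewrite xA mulr1 ger0_norm; last by rewrite lecR invr_ge0 ltW.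
by rewrite rmorphV ?unitfE ?gt_eqF// -(ler_pM2l q0C) mulVKf ?gt_eqF// mulr1.
Qed.

Lemma contraction_pointwise (u : L0H E) :
  {ae mu, forall x, `|L0H_val (S u) x| <= `|L0H_val u x|}.
Proof.
have : {ae mu, forall x, forall q : rat, 0 < q ->
    `|L0H_val u x| <= (ratr q)%:C%C -> `|L0H_val (S u) x| <= (ratr q)%:C%C}.
  apply: ae_forall_countable => q; have [q0|_] := boolP (0 < q).
    by apply: filterS (contraction_pointwise_bound u q0) => x h _.
  exact: aeW.
apply: filterS => x h; rewrite -(ge0_ReE (normr_ge0 (L0H_val u x))).
rewrite -(ge0_ReE (normr_ge0 (L0H_val (S u) x))) lecR.
apply/ler_addgt0Pr => e e0.
have u0 : 0 <= complex.Re `|L0H_val u x| by rewrite -(@lecR R) ge0_ReE//; exact: normr_ge0.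
have [|q] := @rat_in_itvoo _ (complex.Re `|L0H_val u x|)
  (complex.Re `|L0H_val u x| + e); first by lra.
rewrite in_itv /= => /andP[uq qe]; apply: le_trans (ltW qe).
rewrite -lecR ge0_ReE//; apply: h; first by rewrite -(@ltr0q R) (le_lt_trans u0).
by rewrite -[leLHS]ge0_ReE// lecR ltW.
Qed.

(** By linearity [S] shifts a combination of the orbit by one step; [contraction_pointwise] is
    applied to each of the countably many finite lists of rational coefficients. *)
Lemma orbit_pointwise_contraction (u : L0H E) : {ae mu, forall x,
  forall n (c : nat -> R[i]),
    `|\sum_(k < n) c k *: L0H_val (iter k.+1 S u) x| <=
    `|\sum_(k < n) c k *: L0H_val (iter k S u) x|}.
Proof.
have : {ae mu, forall x, forall q : seq (rat * rat),
    `|\sum_(k < size q) complex_of_rat R (nth (0, 0) q k) *: L0H_val (iter k.+1 S u) x| <=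
    `|\sum_(k < size q) complex_of_rat R (nth (0, 0) q k) *: L0H_val (iter k S u) x|}.
  apply: ae_forall_countable => q; pose c k := complex_of_rat R (nth (0, 0) q k).
  apply: filter_app (contraction_pointwise
    (\sum_(k < size q) L0_cst mu (c k) *: iter k S u)).
  apply: filter_app (L0H_val_sum (fun k => iter k S u) (size q) c).
  apply: filter_app (L0H_val_sum (fun k => iter k.+1 S u) (size q) c).
  apply: aeW => x Su_E uE; rewrite linear_sum.
  under [in L0H_val _ x]eq_bigr do rewrite linearZ.
  by rewrite Su_E uE.
apply: filterS => x h n c.
apply: (@le_norm_sum_rat R (E x) n (fun k => L0H_val (iter k S u) x)
  (fun k => L0H_val (iter k.+1 S u) x) _ c) => q.
have := h (mkseq q n); rewrite size_mkseq.
have e (v : nat -> E x) : \sum_(k < n) complex_of_rat R (nth (0, 0) (mkseq q n) k) *: v k =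
    \sum_(k < n) complex_of_rat R (q k) *: v k.
  by apply: eq_bigr => k _; rewrite nth_mkseq.
by rewrite (e (fun k => L0H_val (iter k.+1 S u) x)) (e (fun k => L0H_val (iter k S u) x)).
Qed.

End contraction.

                            

(** * From convergence in almost every fibre to convergence in norm *)

Section diagonal.
Context d (T : measurableType d) (R : realType).
Context (mu : {finite_measure set T -> \bar R}).

(** Egorov gives [phi n] with |h n (phi n)| < 1/(n+1) off a set of measure at most 2^-(n+1). These
    measures are summable, so by Borel-Cantelli almost every point lies in only finitely many of the
    sets. *)
Lemma diagonal_ae_cvg0 (h : nat -> nat -> T -> R) :
  (forall n m, measurable_fun setT (h n m)) ->
  (forall n, {ae mu, forall x, h n m x @[m --> \oo] --> (0 : R)}) ->
  exists phi : nat -> nat, {ae mu, forall x, h n (phi n) x @[n --> \oo] --> (0 : R)}.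
Proof.
move=> mh h0; pose eps n : R := 1 / (2 ^ n.+1)%:R.
have eps0 n : 0 < eps n by rewrite divr_gt0// ltr0n expn_gt0.
have muT : (mu setT < +oo)%E by rewrite ltey_eq fin_num_measure.
have /choice[B hB] : forall n, exists B : set T * nat, [/\ measurable B.1,
    (mu B.1 <= (eps n)%:E)%E &
    forall x, ~ B.1 x -> `|h n B.2 x| < n.+1%:R^-1].
  move=> n; have [|B [mB Beps]] := @ae_pointwise_almost_uniform _ _ _ mu (h n)
    (fun=> 0) setT (eps n) (mh n) (measurable_cst _) measurableT muT _ (eps0 n).
    by apply: filterS (h0 n) => x hx _.
  move=> Bunif; have n0 : 0 < n.+1%:R^-1 :> R by rewrite invr_gt0.
  have : nbhs ((fun=> 0) : {uniform` setT `\` B -> R})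
      [set g | forall y, (setT `\` B) y -> `|g y| < n.+1%:R^-1].
    apply/uniform_nbhs; exists [set xy | ball xy.1 n.+1%:R^-1 xy.2].
    split; first exact: (entourage_ball _ (PosNum n0)).
    by move=> g /= hg y By; have := hg y By; rewrite /ball/= sub0r normrN.
  move=> /Bunif [m _ /(_ m (leqnn m)) hm]; exists (B, m); split => //=.
    exact: ltW.
  by move=> x Bx; apply: hm.
exists (fun n => (B n).2); exists (lim_sup_set (fun n => (B n).1)); split.
- apply: bigcap_measurable => // n _; apply: bigcup_measurable => k _.
  by have [] := hB k.
- apply: lim_sup_set_cvg0 => [k|]; first by have [] := hB k.
  apply: (@le_lt_trans _ _ 1%E); last exact: ltry.
  have := @cvg_geometric_eseries_half R 1 0; rewrite expr0 divr1.
  move=> /cvg_lim <- //; apply: lee_nneseries => [n _ _|n _].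
    exact: measure_ge0.
  by have [_ + _] := hB n; rewrite addn1.
- move=> x /=; apply: contra_notP => xB.
  have [N hN] : exists N, forall n, (N <= n)%N -> ~ (B n).1 x.
    apply: contrapT => /forallNP H; apply: xB => N _.
    have /existsNP[n /not_implyP[Nn /contrapT Bx]] := H N.
    by exists n.
  apply: (@squeeze_cvgr _ _ _ _ (fun n => - harmonic n) harmonic).
  + exists N => // n /= /hN Bx; have [_ _ /(_ x Bx)/ltW] := hB n.
    by rewrite ler_norml.
  + by rewrite -oppr0; apply: cvgN; exact: cvg_harmonic.
  + exact: cvg_harmonic.
Qed.

End diagonal.

Section norm_convergence.
Context (R : realType) (V : normedModType R[i]).
Implicit Type y : nat -> V.

Lemma cvg_Re_norm0P y : y n @[n --> \oo] --> (0 : V) <->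
  complex.Re `|y n| @[n --> \oo] --> (0 : R).
Proof.
have nE (v : V) : `|v| = (complex.Re `|v|)%:C%C by rewrite ge0_ReE.
have n0 (v : V) : 0 <= complex.Re `|v|.
  by rewrite -(@lecR R) -nE; exact: normr_ge0.
split=> /cvgrPdist_lt h; apply/cvgrPdist_lt => e e0.
  have eC0 : 0 < e%:C%C :> R[i] by rewrite ltcR.
  have [N _ hN] := h _ eC0; exists N => // n /= /hN /=.
  by rewrite !sub0r !normrN [X in (X < _) -> _]nE ltcR ger0_norm.
have e'0 : 0 < complex.Re e by rewrite -(@ltcR R) ge0_ReE// ltW.
have [N _ hN] := h _ e'0; exists N => // n /= /hN /=.
by rewrite !sub0r !normrN ger0_norm// -(@ltcR R) -nE ge0_ReE// ltW.
Qed.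

End norm_convergence.

Section order_convergence.
Context d (T : measurableType d) (R : realType) (mu : {measure set T -> \bar R}).

(** The dominating sequence consists of the tail suprema of [f]. They decrease to 0 pointwise, so a
    lower bound of all of them is at most 0. *)
Lemma ae_cvg0_order_cvg (f : nat -> L0 mu) :
  (forall n, {ae mu, forall x, 0 <= f n x}) ->
  {ae mu, forall x, complex.Re (f n x) @[n --> \oo] --> (0 : R)} ->
  L0_order_cvg f 0.
Proof.
move=> f0 [N [mN N0 subN]].
(* Cutting off the null set makes the convergence hold everywhere, so that every tail supremum is a
   genuine finite one. *)
pose h n x : R := complex.Re (f n x) * \1_(~` N) x.
have h0 x : h n x @[n --> \oo] --> (0 : R).
  rewrite /h indicE; have [xN|xN] := boolP (x \in ~` N); last first.
    by under eq_fun do rewrite mulr0; exact: cvg_cst.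
  rewrite -(mul0r (true%:R : R)); apply: cvgMr_tmp.
  have {}xN : ~ N x by move: xN; rewrite inE.
  by have /contrapT := contra_not (@subN x) xN.
have hub x : has_ubound (range (h ^~ x)).
  have [M hM] := cvg_has_ub (cvgP _ (h0 x)).
  by exists M => _ [n _ <-]; apply: le_trans (ler_norm _) _; apply: hM; exists n.
have mg n : measurable_fun setT (fun x => (sups (h ^~ x) n)%:C%C : R[i]).
  apply/measurable_fun_complexP; split => //=; apply: measurable_fun_sups => // m.
  apply: measurable_funM.
    exact: L0_Re_measurable.
  by apply: measurable_indic; exact: measurableC.
pose g n := L0_mk mu (mg n).
have aeN : {ae mu, forall x, ~ N x}.
  by exists N; split => // x /= /contrapT.
have le_sups n x : h n x <= sups (h ^~ x) n.
  apply: ub_le_sup; last by exists n => /=.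
  exact: has_ubound_sdrop.
have fg n : {ae mu, forall x, f n x <= g n x}.
  apply: filter_app (f0 n); apply: filter_app (L0_mkE mu (mg n)).
  apply: filterS aeN => x xN -> fx0; rewrite -[leLHS]ge0_ReE// lecR.
  by rewrite (le_trans _ (le_sups n x))// /h indicE mem_set ?mulr1.
have lb_le0 (z : L0 mu) : (forall n, z <= g n) -> z <= 0.
  move=> zg; apply/L0_leP.
  have /ae_foralln zgn : forall n, {ae mu, forall x, z x <= (sups (h ^~ x) n)%:C%C}.
    move=> n; have /L0_leP := zg n.
    by apply: filterS2 (L0_mkE mu (mg n)) => x ->.
  apply: filterS2 (L0_cstE mu 0) zgn => x -> zx.
  have s0 : sups (h ^~ x) n @[n --> \oo] --> (0 : R) by exact: cvg_sups.
  (* Being comparable with a real number forces the imaginary part b to vanish; the real part then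
     passes to the limit. *)
  have := zx 0%N; case: (z x) zx => a b zx.
  rewrite !lecE /= => /andP[b0 _]; rewrite b0 /=.
  apply: (ler_cvg_to (cvg_cst a) s0); apply: nearW => n.
  by have := zx n; rewrite lecE /= => /andP[].
exists g; split.
- move=> n m nm; apply/L0_leP.
  apply: filterS2 (L0_mkE mu (mg n)) (L0_mkE mu (mg m)) => x -> ->.
  by rewrite lecR nonincreasing_sups.
- split.
    move=> _ [n _ <-]; apply/L0_leP; apply: filter_app (L0_cstE mu 0).
    by apply: filterS2 (f0 n) (fg n) => x fx0 fg1 ->; exact: le_trans fg1.
  by move=> z zg; apply: lb_le0 => n; apply: zg; exists n.
- move=> n; rewrite sub0r add0r; apply/andP; split; apply/L0_leP.
    apply: filter_app (L0_oppE (g n)).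
    by apply: filterS2 (f0 n) (fg n) => x fx0 fgx ->; rewrite (le_trans _ fx0)// oppr_le0 (le_trans fx0).
  exact: fg.
Qed.

End order_convergence.

Section measurable_limit.
Context d (T : measurableType d) (R : realType).
Context (mu : {finite_measure set T -> \bar R}) (cmu : measure_is_complete mu).
Context (E : hilbert_bundle mu).

Lemma L0H_normBE (u v : L0H E) :
  {ae mu, forall x, L0H_norm cmu (u - v) x = `|L0H_val u x - L0H_val v x|}.
Proof.
apply: filter_app (L0H_normE cmu (u - v)).
apply: filter_app (L0H_addE u (- v)).
by apply: filterS (L0H_oppE v) => x vE aE ->; rewrite aE vE.
Qed.

Lemma step_approximation (u : L0H E) : exists s : nat -> L0H E,
  (forall m, exists2 t : aesection mu E, step_section t &
    {ae mu, forall x, L0H_val (s m) x = sec_val t x}) /\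
  {ae mu, forall x, complex.Re (L0H_norm cmu (s m - u) x) @[m --> \oo] --> (0 : R)}.
Proof.
have [t [st tu]] := msec_measurable (repr u).
have mt m : measurable_section (t m).
  exists (fun=> t m); split => //; apply: aeW => x.
  by rewrite subrr normr0; exact: cvg_cst.
exists (fun m => L0H_mk (MSection (mt m))); split.
  by move=> m; exists (t m) => //; exact: (L0H_mkE (MSection (mt m))).
have /ae_foralln tE : forall m,
    {ae mu, forall x, L0H_val (L0H_mk (MSection (mt m))) x = sec_val (t m) x}.
  by move=> m; exact: (L0H_mkE (MSection (mt m))).
have /ae_foralln nE : forall m, {ae mu, forall x,
    L0H_norm cmu (L0H_mk (MSection (mt m)) - u) x =
    `|L0H_val (L0H_mk (MSection (mt m))) x - L0H_val u x|}.
  by move=> m; exact: L0H_normBE.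
apply: filterS3 tu tE nE => x tux tEx nEx.
rewrite (_ : (fun m => _) = fun m => complex.Re `|sec_val (t m) x - L0H_val u x|).
  by apply/cvg_Re_norm0P/norm_cvg0P.
by apply/funext => m; rewrite nEx tEx.
Qed.

(** Measurable sections are closed under almost everywhere limits: the diagonal lemma selects for
    each n a step-section so near to [u n] that the differences tend to 0 almost everywhere. *)
Lemma mapprox_limit (u : nat -> L0H E) (f : forall x, E x) :
  {ae mu, forall x, L0H_val (u n) x @[n --> \oo] --> f x} -> mapprox f.
Proof.
move=> uf; have /choice[s hs] := fun n => step_approximation (u n).
have [phi hphi] := @diagonal_ae_cvg0 _ _ _ mu
  (fun n m x => complex.Re (L0H_norm cmu (s n m - u n) x))
  (fun n m => L0_Re_measurable _)
  (fun n => (hs n).2).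
exists (fun n => L0H_val (s n (phi n))); split.
  move=> n; have [t [k [A [c [mA cE ->]]]] st] := (hs n).1 (phi n).
  exists 'I_k, A, c; split => //; apply: filterS2 st
    (sec_onE (sec_dom_bigcap_ae c) (fun x => \sum_(i < k) \1_(A i) x *: sec_val (c i) x)).
  by move=> x -> ->.
have /ae_foralln nE : forall n, {ae mu, forall x,
    L0H_norm cmu (s n (phi n) - u n) x =
    `|L0H_val (s n (phi n)) x - L0H_val (u n) x|}.
  by move=> n; exact: L0H_normBE.
apply: filterS3 uf hphi nE => x ufx hx nEx.
have : L0H_val (s n (phi n)) x - L0H_val (u n) x @[n --> \oo] --> (0 : E x).
  by apply/cvg_Re_norm0P; move: hx; under eq_fun do rewrite nEx.
move=> su0; rewrite -[f x]add0r.
rewrite [X in X @ _](_ : _ = fun n => L0H_val (s n (phi n)) x -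
    L0H_val (u n) x + L0H_val (u n) x).
  exact: cvgD su0 ufx.
by apply/funext => n; rewrite subrK.
Qed.

Lemma ae_cvg_in_norm (u : nat -> L0H E) :
  {ae mu, forall x, cvg (L0H_val (u n) x @[n --> \oo])} -> cvg_in_norm cmu u.
Proof.
move=> uc; pose f x : E x := lim (L0H_val (u n) x @[n --> \oo]).
have uf : {ae mu, forall x, L0H_val (u n) x @[n --> \oo] --> f x} by [].
have aeT : {ae mu, forall x, [set: T] x} by exact: aeW.
have mf := mapprox_section (mapprox_limit uf) (sec_onE aeT f).
pose v := L0H_mk (MSection mf); exists v; apply: ae_cvg0_order_cvg.
  by move=> n; apply: filterS (L0H_normBE (u n) v) => x ->.
have /ae_foralln nE : forall n, {ae mu, forall x,
    L0H_norm cmu (u n - v) x = `|L0H_val (u n) x - L0H_val v x|}.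
  by move=> n; exact: L0H_normBE.
have vf : {ae mu, forall x, L0H_val v x = f x}.
  by apply: filterS2 (L0H_mkE (MSection mf)) (sec_onE aeT f) => x -> ->.
apply: filterS3 uf vf nE => x ufx vfx nEx.
under eq_fun do rewrite nEx vfx.
by apply/cvg_Re_norm0P/subr_cvg0.
Qed.

End measurable_limit.

Lemma L0H_val_modulated_average d (T : measurableType d) (R : realType)
    (mu : {measure set T -> \bar R}) (E : hilbert_bundle mu) (a : nat -> R[i])
    (S : L0H E -> L0H E) n (u : L0H E) :
  {ae mu, forall x, L0H_val (modulated_average a S n u) x =
    average a (fun k => L0H_val (iter k S u) x) n}.
Proof.
apply: filter_app (L0H_scaleE (L0_cst mu n%:R^-1)
  (\sum_(k < n) L0_cst mu (a k) *: iter k S u)).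
apply: filter_app (L0_cstE mu n%:R^-1).
by apply: filterS (L0H_val_sum (fun k => iter k S u) n a) => x sE cE ->; rewrite cE sE.
Qed.

Local Open Scope complex_scope.

Theorem theorem4p1 (d : measure_display) (T : measurableType d) (R : realType)
    (mu : {finite_measure set T -> \bar R}) (cmu : measure_is_complete mu)
    (E : hilbert_bundle mu) (a : nat -> R[i])
    (ha : forall l : R[i], `|l| = 1 -> exists c : R[i],
      (n%:R^-1 * \sum_(k < n) a k * (l^*) ^+ k : R[i]^o) @[n --> \oo]
        --> (c : R[i]^o))
    (hb : exists M : R, forall n : nat, (0 < n)%N -> forall l : R[i], `|l| = 1 ->
      `|n%:R^-1 * \sum_(k < n) a k * l ^+ k| <= M%:C)
    (S : {linear L0H E -> L0H E}) (hS : L0_contraction cmu S) (u : L0H E) :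
  cvg_in_norm cmu (fun n => modulated_average a S n u).
Proof.
apply: ae_cvg_in_norm.
have /ae_foralln avgE : forall n, {ae mu, forall x,
    L0H_val (modulated_average a S n u) x =
    average a (fun k => L0H_val (iter k S u) x) n}.
  by move=> n; exact: L0H_val_modulated_average.
apply: filterS2 (orbit_pointwise_contraction hS u) avgE => x contr avgEx.
under eq_fun do rewrite avgEx.
exact: (@average_cvg R a ha hb (E x) (fun k => L0H_val (iter k S u) x) contr).
Qed.
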